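(* Let $X$ and $W$ be independent unconditional log-concave random vectors in $\mathbb{R}^d$. Then for any strong contraction $T:\mathbb{R}^d\to\mathbb{R}^d$, $$f_{X+W}\preceq f_{T(X)+W},$$ and consequently $h_\alpha(T(X)+W)\le h_\alpha(X+W)$ for all $\alpha\in(0,\infty)$.
   Context: A map $T=(T_1,\dots,T_d):\mathbb{R}^d\to\mathbb{R}^d$ is a strong contraction if $|T_i(x)-T_i(y)|\le|x_i-y_i|$ for all $i=1,\dots,d$ and all $x,y\in\mathbb{R}^d$. $f_Y$ denotes the density of a random vector $Y$ with respect to Lebesgue measure on $\mathbb{R}^d$. A random vector is log-concave if it has a density of the form $e^{-\phi}$ with $\phi:\mathbb{R}^d\to(-\infty,\infty]$ convex. A random vector $X=(X_1,\dots,X_d)$ is unconditional if $(\pm X_1,\dots,\pm X_d)$ has the same distribution as $X$ for every choice of signs. Rényi entropy: for $Y$ with density $f$, $h_\alpha(Y)=\frac{1}{1-\alpha}\log\int_{\mathbb{R}^d} f^\alpha$ for $\alpha\in(0,1)\cup(1,\infty)$, and $h_1(Y)=-\int f\log f$ (natural logarithm). Rearrangement and majorization: for a Borel set $A$ of positive finite volume, $A^*$ is the open Euclidean ball centered at $0$ with the same volume as $A$. For a nonnegative measurable $f$ vanishing at infinity, its symmetrically decreasing rearrangement $f^*$ is the (a.e. unique) function with $\{f^*>t\}=\{f>t\}^*$ for all $t>0$. For probability densities $f,g$ on $\mathbb{R}^d$, $f\preceq g$ (''$f$ is majorized by $g$'') means $\int_{B(0,r)}f^*\,dx\le\int_{B(0,r)}g^*\,dx$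 for all $r>0$, where $B(0,r)$ is the open Euclidean ball of radius $r$ centered at $0$. *)

(* Defs.v *)
(* R^d is the type d.-tuple R: its canonical sigma-algebra, generated by the
   coordinates, is the Borel sigma-algebra of R^d. *)
From HB Require Import structures.
From mathcomp Require Import all_boot all_order all_algebra.
From mathcomp Require Import all_classical all_reals all_analysis.

Set Implicit Arguments.
Unset Strict Implicit.
Unset Printing Implicit Defensive.
Import Order.TTheory GRing.Theory Num.Theory.
Import numFieldNormedType.Exports.
Local Open Scope classical_set_scope.
Local Open Scope ring_scope.

Section vectors.
Context {R : realType} {d : nat}.
Implicit Types (x y : d.-tuple R) (r a : R).

Definition vadd x y : d.-tuple R := [tuple tnth x i + tnth y i | i < d].

Definition vscale a x : d.-tuple R := [tuple a * tnth x i | i < d].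

Definition vflip (s : {ffun 'I_d -> bool}) x : d.-tuple R :=
  [tuple (-1) ^+ s i * tnth x i | i < d].

Definition enorm x : R := Num.sqrt (\sum_(i < d) tnth x i ^+ 2).

Definition eball r : set (d.-tuple R) := [set x | enorm x < r].

Definition strong_contraction (T : d.-tuple R -> d.-tuple R) : Prop :=
  forall (i : 'I_d) x y,
    `|tnth (T x) i - tnth (T y) i| <= `|tnth x i - tnth y i|.

(* The product 0 * +oo is 0, so the endpoints a = 0 and a = 1 are harmless. *)
Definition convex_ereal (phi : d.-tuple R -> \bar R) : Prop :=
  (forall x, -oo < phi x)%E /\
  forall x y a, 0 <= a <= 1 ->
    (phi (vadd (vscale a x) (vscale (1 - a) y))
       <= a%:E * phi x + (1 - a)%:E * phi y)%E.

End vectors.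

Section lebesgue_tuple_step.
Context {R : realType} {n : nat}.

Definition consp (p : measurableTypeR R * n.-tuple R) : n.+1.-tuple R :=
  [tuple of p.1 :: p.2].

Lemma measurable_consp :
  measurable_fun [set: measurableTypeR R * n.-tuple R] consp.
Proof.
apply: (@measurable_cons _ _ _ R (fun p => p.1) n (fun p => p.2)).
  exact: (@measurable_fst _ _ (measurableTypeR R) (n.-tuple R)).
exact: (@measurable_snd _ _ (measurableTypeR R) (n.-tuple R)).
Qed.

Lemma measurable_unconsp :
  measurable_fun setT (fun t : n.+1.-tuple R =>
    (thead t, [tuple of behead t]) : measurableTypeR R * n.-tuple R).
Proof.
apply/measurable_fun_pairP; split.
  exact: (measurable_tnth (T := R) (n := n.+1) ord0).
exact: measurable_behead.
Qed.

Lemma unconspK : cancel (fun t : n.+1.-tuple R =>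
    (thead t, [tuple of behead t]) : measurableTypeR R * n.-tuple R) consp.
Proof. by move=> t; rewrite /consp /= -tuple_eta. Qed.

Lemma conspK : cancel consp (fun t : n.+1.-tuple R =>
    (thead t, [tuple of behead t]) : measurableTypeR R * n.-tuple R).
Proof.
by case=> a t; rewrite /consp /= theadE; congr (_, _); apply: val_inj.
Qed.

Variable mu : {sigma_finite_measure set (n.-tuple R) -> \bar R}.

Definition lebesgue_cons : set (n.+1.-tuple R) -> \bar R :=
  pushforward (@lebesgue_measure R \x mu)%E consp.

Let preim_measurable (A : set (n.+1.-tuple R)) :
  measurable A -> measurable (consp @^-1` A).
Proof. by move=> mA; rewrite -[X in measurable X]setTI; exact: measurable_consp. Qed.

Let lebesgue_cons0 : lebesgue_cons set0 = 0%E.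
Proof. by rewrite /lebesgue_cons /pushforward preimage_set0 measure0. Qed.

Let lebesgue_cons_ge0 A : (0 <= lebesgue_cons A)%E.
Proof. by rewrite /lebesgue_cons /pushforward measure_ge0. Qed.

Let lebesgue_cons_sigma_additive : semi_sigma_additive lebesgue_cons.
Proof.
move=> F mF tF mUF; rewrite /lebesgue_cons /pushforward preimage_bigcup.
apply: measure_semi_sigma_additive.
- by move=> k; exact: preim_measurable.
- apply/trivIsetP => /= i j _ _ ij; rewrite -preimage_setI.
  by move/trivIsetP : tF => /(_ _ _ _ _ ij) ->//; rewrite preimage_set0.
- by rewrite -preimage_bigcup; exact: preim_measurable.
Qed.

HB.instance Definition _ := isMeasure.Build _ _ _ lebesgue_cons
  lebesgue_cons0 lebesgue_cons_ge0 lebesgue_cons_sigma_additive.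

Let lebesgue_cons_sigma_finite : sigma_finite setT lebesgue_cons.
Proof.
have /sigma_finiteP[F [TF ndF Foo]] := sigma_finiteT (@lebesgue_measure R).
have /sigma_finiteP[G [TG ndG Goo]] := sigma_finiteT mu.
pose g (t : n.+1.-tuple R) : measurableTypeR R * n.-tuple R :=
  (thead t, [tuple of behead t]).
exists (fun k => g @^-1` (F k `*` G k)).
  apply/esym; rewrite -subTset => t _.
  have [i _ Fi] : (\bigcup_k F k) (g t).1 by rewrite -TF.
  have [j _ Gj] : (\bigcup_k G k) (g t).2 by rewrite -TG.
  exists (maxn i j) => //; split.
  - by move: Fi; exact/subsetPset/ndF/leq_maxl.
  - by move: Gj; exact/subsetPset/ndG/leq_maxr.
move=> k; have [mFk Fk] := Foo k; have [mGk Gk] := Goo k; split.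
  rewrite -[X in measurable X]setTI; apply: measurable_unconsp => //.
  exact: measurableX.
rewrite /lebesgue_cons /pushforward.
have -> : consp @^-1` (g @^-1` (F k `*` G k)) = F k `*` G k.
  by rewrite -comp_preimage (_ : g \o consp = id)//; exact/funext/conspK.
by rewrite product_measure1E// lte_mul_pinfty// ge0_fin_numE.
Qed.

HB.instance Definition _ := Measure_isSigmaFinite.Build _ _ _ lebesgue_cons
  lebesgue_cons_sigma_finite.

End lebesgue_tuple_step.

(* The Lebesgue measure of R^d, as the iterated product of lebesgue_measure. *)
Fixpoint lebesgue_tuple {R : realType} (d : nat) :
    {sigma_finite_measure set (d.-tuple R) -> \bar R} :=
  match d with
  | 0 => dirac [tuple of [::]]
  | n.+1 => lebesgue_cons (lebesgue_tuple n)
  end.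

Lemma lebesgue_tuple_box {R : realType} (d : nat) (A : 'I_d -> set R) :
  (forall i, measurable (A i)) ->
  lebesgue_tuple d [set x | forall i, A i (tnth x i)]
    = (\prod_(i < d) @lebesgue_measure R (A i))%E.
Proof.
elim: d A => [|n IHn] A mA.
  rewrite big_ord0 /= diracE mem_set//.
  by move=> i; have := ltn_ord i.
rewrite big_ord_recl -IHn; last by move=> i; exact: mA.
rewrite /= /lebesgue_cons /pushforward.
pose B := [set x : n.-tuple R | forall i, A (lift ord0 i) (tnth x i)].
have -> : consp @^-1` [set x | forall i, A i (tnth x i)] = A ord0 `*` B.
  apply/seteqP; split=> [[a t]|[a t]] /=.
    move=> h; split; first exact: (h ord0).
    by move=> i; have := h (lift ord0 i); rewrite tnthS.
  move=> [h0 h] i; case: (unliftP ord0 i) => [j|] ->; last exact: h0.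
  by rewrite tnthS; exact: h.
rewrite product_measure1E//; first exact: (mA ord0).
have -> : B = \bigcap_(i in [set: 'I_n])
    ((fun x : n.-tuple R => tnth x i) @^-1` A (lift ord0 i)).
  by apply/seteqP; split => [x h i _|x h i]; [exact: h|exact: (h i)].
apply: fin_bigcap_measurable => // i _.
by rewrite -[X in measurable X]setTI; exact: measurable_tnth.
Qed.

Section densities.
Local Open Scope ereal_scope.
Context {R : realType} {d : nat}.
Implicit Types (f g : d.-tuple R -> R).

(* B = A^*.  The radius 0 covers null sets A, whose rearrangement is empty; a
   set of infinite volume has no rearrangement. *)
Definition set_rearrangement (A B : set (d.-tuple R)) : Prop :=
  exists r : R, [/\ (0 <= r)%R, B = eball r &
                    lebesgue_tuple d B = lebesgue_tuple d A].

(* fs = f^*.  Such an fs is unique, since its superlevel sets at all t > 0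
   determine it, and it exists when f vanishes at infinity.  It is
   extended-real valued because it takes the value +oo at the origin when f is
   essentially unbounded. *)
Definition fun_rearrangement f (fs : d.-tuple R -> \bar R) : Prop :=
  (forall x, 0 <= fs x) /\
  forall t : R, (0 < t)%R ->
    set_rearrangement [set x | (t < f x)%R] [set x | t%:E < fs x].

Definition majorized f g : Prop :=
  exists fs gs, [/\ fun_rearrangement f fs, fun_rearrangement g gs &
    forall r : R, (0 < r)%R ->
      \int[lebesgue_tuple d]_(x in eball r) fs x
        <= \int[lebesgue_tuple d]_(x in eball r) gs x].

(* Integrals and values are extended-real; 0 * ln 0 and 0 `^ alpha (alpha > 0)
   are 0 by the library conventions. *)
Definition renyi_entropy (alpha : R) f : \bar R :=
  if alpha == 1%R then - \int[lebesgue_tuple d]_x (f x * ln (f x))%:E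
  else ((1 - alpha)^-1)%:E * lne (\int[lebesgue_tuple d]_x (f x `^ alpha)%:E).

End densities.

Section random_vectors.
Local Open Scope ereal_scope.
Context {R : realType} {d : nat} {disp : measure_display}
  {Omega : measurableType disp} (P : probability Omega R).
Implicit Types (X Y W : Omega -> d.-tuple R) (f : d.-tuple R -> R).

Definition has_density Y f : Prop :=
  [/\ measurable_fun setT Y, measurable_fun setT f, forall x, (0 <= f x)%R &
      forall A, measurable A ->
        pushforward P Y A = \int[lebesgue_tuple d]_(x in A) (f x)%:E].

Definition log_concave X : Prop :=
  exists f (phi : d.-tuple R -> \bar R),
    [/\ has_density X f, convex_ereal phi & forall x, (f x)%:E = expeR (- phi x)].

Definition unconditional X : Prop :=
  forall (s : {ffun 'I_d -> bool}) A, measurable A ->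
    pushforward P (vflip s \o X) A = pushforward P X A.

Definition independent X W : Prop :=
  forall A B, measurable A -> measurable B ->
    P (X @^-1` A `&` W @^-1` B) = P (X @^-1` A) * P (W @^-1` B).

End random_vectors.

(* Main.v *)
(** Call a function on R^d solid if it is nonincreasing in every |x_i|.

    A log-concave unconditional density has a solid version: it is
    quasi-concave, and a.e. invariant under sign flips.  The correlation
    x |-> \int F(x + w) G(w) dw of a solid F >= 0 with a solid G >= 0 is solid;
    this is a one-coordinate-at-a-time reflection argument, so neither
    log-concavity of convolutions nor the Prekopa-Leindler inequality is used.
    Since a strong contraction satisfies |T(x)_i - T(0)_i| <= |x_i|, conditioning
    on X gives E F(X + W) <= E F(T(X) + W - T(0)) for every solid F >= 0, and the
    reverse inequality when F is nondecreasing in every |x_i|.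

    Let f be the solid density of X + W and g a density of T(X) + W.  With
    F = 1_{f > t} the comparison gives \int (f - t)_+ <= \int (g - t)_+ for all
    t >= 0, which is equivalent to majorization.  With F = f^(alpha-1) or
    F = ln M - ln f, and the tangent-line inequality of the convex or concave
    function a |-> a^alpha or a ln a at the point f, it gives the comparison of
    entropies. *)
Require Import Defs.
From HB Require Import structures.
From mathcomp Require Import all_boot all_order all_algebra.
From mathcomp Require Import all_classical all_reals all_analysis.
From mathcomp Require Import measurable_realfun ring lra.
Set Implicit Arguments.
Unset Strict Implicit.
Unset Printing Implicit Defensive.
Import Order.TTheory GRing.Theory Num.Theory.
Import numFieldNormedType.Exports.
Local Open Scope classical_set_scope.
Local Open Scope ring_scope.

(** Names the measure structure that a measurable map puts on a pushforward, so that it can be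
    passed where a bundled measure is expected. *)
Definition measure_pushforward d d' (T1 : measurableType d)
    (T2 : measurableType d') (R : realType) (m : {measure set T1 -> \bar R})
    (f : T1 -> T2) (mf : measurable_fun setT f) : {measure set T2 -> \bar R} :=
  measure_function_pushforward__canonical__measure_function_Measure m mf.

(** * Diagonal affine changes of variables *)

Section affine_change_of_variables.
Context {R : realType}.
Local Open Scope ereal_scope.

Lemma measurable_affine (c b : R) : measurable_fun setT
  (fun x : measurableTypeR R => (c * x + b)%R : measurableTypeR R).
Proof. by apply: measurable_funD => //; exact: measurable_funM. Qed.

(** Scaling the image measure by [|c|] gives a measure that agrees with Lebesgue measure on the
    intervals []a, a']], hence on all measurable sets. The sign of [c] decides which end of the
    preimage is closed. *)
Lemma lebesgue_measure_affine (c b : R) (A : set R) : c != 0%R -> measurable A ->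
  `|c|%:E * lebesgue_measure ((fun x => c * x + b)%R @^-1` A)
    = lebesgue_measure A.
Proof.
move=> c0 mA.
have mf := measurable_affine c b.
pose nu := mscale (NngNum (normr_ge0 c)) (measure_pushforward (@lebesgue_measure R) mf).
apply/esym; rewrite (@lebesgue_measure_unique _ nu)// => _ [[a a']] _ <-.
rewrite -[RHS]/(`|c|%:E * lebesgue_measure ((fun x => c * x + b)%R @^-1` `]a, a']%classic)).
case: (ltgtP c 0%R) c0 => // [c0|c0] _.
- have -> : (fun x => c * x + b)%R @^-1` `]a, a'] = `[((a' - b) / c)%R, ((a - b) / c)%R[%classic.
    apply/seteqP; split => x /=; rewrite !in_itv/=.
    + by rewrite ler_ndivrMr// ltr_ndivlMr// => /andP[? ?]; apply/andP; split; lra.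
    + by rewrite ler_ndivrMr// ltr_ndivlMr// => /andP[? ?]; apply/andP; split; lra.
  rewrite !lebesgue_measure_itv/= !lte_fin ltr_ndivlMr// divfK ?lt_eqF//.
  rewrite (_ : (a - b < a' - b) = (a < a'))%R; last by lra.
  case: ifPn => _; last by rewrite mule0.
  by rewrite -EFinB -EFinB -EFinM; congr EFin; rewrite ltr0_norm//; field; rewrite lt_eqF.
- have -> : (fun x => c * x + b)%R @^-1` `]a, a'] = `]((a - b) / c)%R, ((a' - b) / c)%R]%classic.
    apply/seteqP; split => x /=; rewrite !in_itv/=.
    + by rewrite ler_pdivlMr// ltr_pdivrMr// => /andP[? ?]; apply/andP; split; lra.
    + by rewrite ler_pdivlMr// ltr_pdivrMr// => /andP[? ?]; apply/andP; split; lra.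
  rewrite !lebesgue_measure_itv/= !lte_fin ltr_pdivrMr// divfK ?gt_eqF//.
  rewrite (_ : (a - b < a' - b) = (a < a'))%R; last by lra.
  case: ifPn => _; last by rewrite mule0.
  by rewrite -EFinB -EFinB -EFinM; congr EFin; rewrite gtr0_norm//; field; rewrite gt_eqF.
Qed.

Lemma ge0_integral_affine (c b : R) (F : R -> \bar R) : c != 0%R ->
  measurable_fun setT F -> (forall x, 0 <= F x) ->
  `|c|%:E * \int[lebesgue_measure]_x F (c * x + b)%R = \int[lebesgue_measure]_x F x.
Proof.
move=> c0 mF F0.
have mf := measurable_affine c b.
have := @ge0_integral_pushforward _ _ _ _ _ _ mf lebesgue_measure setT F.
rewrite preimage_setT => <- //.
rewrite -(@ge0_integral_mscale _ _ _ (measure_pushforward lebesgue_measure mf) _ _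
  (NngNum (normr_ge0 c)))//.
apply: eq_measure_integral => A mA _.
exact: lebesgue_measure_affine.
Qed.

(** By construction [lebesgue_tuple n.+1] is the image of a product measure under [consp], so this
    is Tonelli's theorem for the first coordinate against the others. *)
Lemma ge0_integral_consp n (F : n.+1.-tuple R -> \bar R) :
  measurable_fun setT F -> (forall x, 0 <= F x) ->
  \int[lebesgue_tuple n.+1]_x F x =
  \int[lebesgue_measure]_a \int[lebesgue_tuple n]_t F (consp (a, t)).
Proof.
move=> mF F0.
have := @ge0_integral_pushforward _ _ _ _ _ _ (@measurable_consp R n)
  (lebesgue_measure \x lebesgue_tuple n) setT F.
rewrite preimage_setT => -> //.
have mFc : measurable_fun setT (F \o consp).
  by apply: measurableT_comp => //; exact: measurable_consp.
by rewrite fubini_tonelli1// => -[a t]; exact: F0.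
Qed.

(** One family that contains all the changes of variables used below: reflections, sign flips,
    translations and dilations. *)
Definition vaff d (c b x : d.-tuple R) : d.-tuple R :=
  [tuple (tnth c i * tnth x i + tnth b i)%R | i < d].

Lemma measurable_tuple_of d d' (T : measurableType d') (f : 'I_d -> T -> R) :
  (forall i, measurable_fun setT (f i)) ->
  measurable_fun setT (fun x => [tuple f i x | i < d]).
Proof.
move=> mf; apply/measurable_fun_tnthP => i; rewrite (_ : _ \o _ = f i)//.
by apply/funext => x /=; rewrite tnth_mktuple.
Qed.

Lemma measurable_vaff d (c b : d.-tuple R) : measurable_fun setT (vaff c b).
Proof.
apply: measurable_tuple_of => i; apply: measurable_funD => //.
by apply: measurable_funM => //; exact: measurable_tnth.
Qed.

(** Induction on the dimension: the one-dimensional formula treats the first coordinate, and the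
    induction hypothesis treats the others inside the outer integral. *)
Lemma ge0_integral_vaff d (c b : d.-tuple R) (F : d.-tuple R -> \bar R) :
  (forall i, tnth c i != 0)%R -> measurable_fun setT F -> (forall x, 0 <= F x) ->
  (\prod_(i < d) `|tnth c i|)%R%:E * \int[lebesgue_tuple d]_x F (vaff c b x) =
  \int[lebesgue_tuple d]_x F x.
Proof.
elim: d c b F => [|n IHn] c b F c0 mF F0.
  rewrite big_ord0 mul1e; apply: eq_integral => x _.
  by rewrite (tuple0 x) (tuple0 (vaff _ _ _)).
have mFv : measurable_fun setT (F \o vaff c b).
  by apply: measurableT_comp => //; exact: measurable_vaff.
rewrite ge0_integral_consp// [RHS]ge0_integral_consp// big_ord_recl EFinM.
have mFc : measurable_fun setT (F \o consp).
  by apply: measurableT_comp => //; exact: measurable_consp.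
pose G (a : R) := \int[lebesgue_tuple n]_t F (consp (a, t)).
have mG : measurable_fun setT G.
  apply: (@measurable_fun_fubini_tonelli_F _ _ (measurableTypeR R) (n.-tuple R) R
    (lebesgue_tuple n) (F \o consp)) => // x; exact: F0.
have G0 a : 0 <= G a by exact: integral_ge0.
rewrite -[RHS](@ge0_integral_affine (tnth c ord0) (tnth b ord0) G)// -muleA; congr (_ * _).
rewrite -ge0_integralZl//; first last.
- by rewrite lee_fin prodr_ge0.
- by move=> x _; exact: integral_ge0.
- apply: (@measurable_fun_fubini_tonelli_F _ _ (measurableTypeR R) (n.-tuple R) R
    (lebesgue_tuple n) (F \o vaff c b \o consp)) => [|x]; last exact: F0.
  by apply: measurableT_comp => //; exact: measurable_consp.
apply: eq_integral => a _.
pose c' : n.-tuple R := [tuple tnth c (lift ord0 i) | i < n].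
pose b' : n.-tuple R := [tuple tnth b (lift ord0 i) | i < n].
rewrite /G -(IHn c' b' (fun t => F (consp ((tnth c ord0 * a + tnth b ord0)%R, t)))); last 3 first.
- by move=> i; rewrite tnth_mktuple.
- pose p := fun t : n.-tuple R =>
    ((tnth c ord0 * a + tnth b ord0)%R : measurableTypeR R, t).
  rewrite [X in measurable_fun _ X](_ : _ = (F \o consp) \o p)//.
  by apply: measurableT_comp => //; exact: pair1_measurable.
- by move=> t.
congr (_%:E * _).
  by apply: eq_bigr => i _; rewrite tnth_mktuple.
apply: eq_integral => t _; congr F; apply/eq_from_tnth => i.
rewrite tnth_mktuple; case: (unliftP ord0 i) => [j|] ->.
  by rewrite !tnthS !tnth_mktuple.
by rewrite /= /tnth/=.
Qed.

End affine_change_of_variables.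

(** * Solid functions and their correlations *)

Section solid_functions.
Context {R : realType} {d : nat}.
Local Open Scope ereal_scope.
Implicit Types (x y w : d.-tuple R) (F : d.-tuple R -> \bar R) (G : d.-tuple R -> R).

(* The hypothesis only involves the |x_i|, so a solid function is even in each
   coordinate. *)
Definition solid F := forall x y,
  (forall i, `|tnth x i| <= `|tnth y i|)%R -> F y <= F x.

Definition antisolid F := forall x y,
  (forall i, `|tnth x i| <= `|tnth y i|)%R -> F x <= F y.

(** The points [z k], with the first [k] coordinates of [y] and the others of [x], form a chain from
    [x] to [y] in which each link changes a single coordinate. *)
Lemma coordinatewise_abs_le (Q : d.-tuple R -> d.-tuple R -> Prop) :
  (forall x, Q x x) -> (forall y x z, Q x y -> Q y z -> Q x z) ->
  (forall x y i, (forall j, j != i -> tnth x j = tnth y j) ->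
    (`|tnth x i| <= `|tnth y i|)%R -> Q x y) ->
  forall x y, (forall i, `|tnth x i| <= `|tnth y i|)%R -> Q x y.
Proof.
move=> Qxx Qtrans Qstep x y xy.
pose z k : d.-tuple R := [tuple if (i < k)%N then tnth y i else tnth x i | i < d].
suff Qz k : (k <= d)%N -> Q x (z k).
  rewrite (_ : y = z d); first exact: Qz.
  by apply/eq_from_tnth => i; rewrite tnth_mktuple ltn_ord.
elim: k => [_|k IHk kd].
  rewrite (_ : z 0%N = x)//.
  by apply/eq_from_tnth => i; rewrite tnth_mktuple.
apply: (Qtrans (z k)); first exact/IHk/ltnW.
apply: (Qstep _ _ (Ordinal kd)) => [j jk|]; rewrite !tnth_mktuple/=.
  have {}jk : (j == k :> nat) = false by exact: negbTE jk.
  by rewrite [in RHS]ltnS [in RHS]leq_eqVlt jk.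
by rewrite ltnn ltnSn.
Qed.

(** The differences of squares are [(s - t)(s + t + 2w)] and [-(s + t)(s + t + 2w)]. Since
    [|s| <= |t|], the factors [s - t] and [-(s + t)] have the same sign, so both comparisons go the
    same way. *)
Lemma abs_le_reflect (s t w : R) : (`|s| <= `|t| ->
  (`|s + w| <= `|t + w| /\ `|w| <= `|- s - t - w|) \/
  (`|t + w| <= `|s + w| /\ `|- s - t - w| <= `|w|))%R.
Proof.
case: (lerP 0%R t) => t0; [rewrite (ger0_norm t0)|rewrite (ltr0_norm t0)];
  rewrite ler_norml => /andP[? ?];
  case: (lerP (- (s + t))%R (w + w)%R) => wm.
- left; rewrite (@ger0_norm _ (t + w)%R); last lra.
  by rewrite (@ler0_norm _ (- s - t - w)%R) ?ler_norml; last lra; split; apply/andP; split; lra.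
- right; rewrite (@ler0_norm _ (s + w)%R); last lra.
  by rewrite (@ler0_norm _ w) ?ler_norml; last lra; split; apply/andP; split; lra.
- right; rewrite (@ger0_norm _ (s + w)%R); last lra.
  by rewrite (@ger0_norm _ w) ?ler_norml; last lra; split; apply/andP; split; lra.
- left; rewrite (@ler0_norm _ (t + w)%R); last lra.
  by rewrite (@ger0_norm _ (- s - t - w)%R) ?ler_norml; last lra; split; apply/andP; split; lra.
Qed.

(** This is [(b - a)(e - c) >= 0] with [a] and [b] possibly infinite. If [e = 0] then [c = 0] and
    all products vanish; otherwise [b = +oo] makes the right side infinite. *)
Lemma lee_rearrangement (a b : \bar R) (c e : R) : 0 <= a -> a <= b ->
  (0 <= c)%R -> (c <= e)%R -> a * e%:E + b * c%:E <= b * e%:E + a * c%:E.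
Proof.
move=> a0 ab c0 ce; have e0 : (0 <= e)%R by exact: le_trans ce.
have [ee|eN0] := eqVneq e 0%R.
  have -> : c = 0%R by lra.
  by rewrite ee !mule0.
have {}e0 : (0 < e)%R by lra.
move: a b a0 ab => [a| |] [b| |]//; rewrite ?lee_fin.
- by move=> a0 ab; nra.
- move=> a0 _; rewrite [in leRHS]gt0_mulye ?lte_fin//.
  by rewrite addye ?leey// -EFinM.
Qed.

Lemma ge0_integral_isometry (c b : d.-tuple R) F :
  (forall i, `|tnth c i| = 1)%R -> measurable_fun setT F -> (forall x, 0 <= F x) ->
  \int[lebesgue_tuple d]_x F (vaff c b x) = \int[lebesgue_tuple d]_x F x.
Proof.
move=> c1 mF F0; rewrite -[RHS](@ge0_integral_vaff _ _ c b)//; last first.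
  by move=> i; rewrite -normr_eq0 c1 oner_eq0.
by rewrite (eq_bigr (fun=> 1%R))// big1_eq mul1e.
Qed.

(** The expectation of [F(x + W)] when [W] has density [G]. *)
Definition correlation F G x := \int[lebesgue_tuple d]_w (F (vadd x w) * (G w)%:E).

Lemma measurable_vaddl x : measurable_fun setT (vadd x).
Proof.
apply: measurable_tuple_of => i; apply: measurable_funD => //.
exact: measurable_tnth.
Qed.

(* The reflection w_i |-> - x_i - y_i - w_i exchanges |x_i + w_i| and
   |y_i + w_i|.  Averaging the two correlations over it reduces their comparison
   to a pointwise rearrangement inequality. *)
Section correlation_step.
Variables (F : d.-tuple R -> \bar R) (G : d.-tuple R -> R).
Hypotheses (mF : measurable_fun setT F) (F0 : forall x, 0 <= F x).
Hypotheses (mG : measurable_fun setT G) (G0 : forall x, (0 <= G x)%R).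

Let reflect (i : 'I_d) (a : R) : d.-tuple R -> d.-tuple R :=
  vaff [tuple (if j == i then -1 else 1)%R | j < d]
       [tuple (if j == i then a else 0)%R | j < d].

Let reflectE i a w j :
  tnth (reflect i a w) j = (if j == i then a - tnth w j else tnth w j)%R.
Proof. by rewrite !tnth_mktuple; case: ifPn => _; lra. Qed.

Let mFG x : measurable_fun setT (fun w => F (vadd x w) * (G w)%:E).
Proof.
apply: emeasurable_funM; last exact/measurable_EFinP.
exact: (measurableT_comp mF (measurable_vaddl x)).
Qed.

Let correlation2E x y i :
    (forall u v, (forall j, `|tnth u j| = `|tnth v j|)%R -> F u = F v) ->
    (forall j, j != i -> tnth x j = tnth y j) ->
  correlation F G x + correlation F G x =
  \int[lebesgue_tuple d]_w (F (vadd x w) * (G w)%:E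
    + F (vadd y w) * (G (reflect i (- tnth x i - tnth y i)%R w))%:E).
Proof.
move=> evF xy; set r := reflect _ _.
have mr : measurable_fun setT r by exact: measurable_vaff.
rewrite ge0_integralD//; first last.
- apply: emeasurable_funM; last by apply/measurable_EFinP; exact: measurableT_comp.
  exact: (measurableT_comp mF (measurable_vaddl y)).
- by move=> w _; rewrite mule_ge0// lee_fin.
- by move=> w _; rewrite mule_ge0// lee_fin.
congr (_ + _); rewrite /correlation.
rewrite -(@ge0_integral_isometry [tuple (if j == i then -1 else 1)%R | j < d]
       [tuple (if j == i then (- tnth x i - tnth y i) else 0)%R | j < d]
       (fun w => F (vadd x w) * (G w)%:E))//; first last.
- by move=> w; rewrite mule_ge0// lee_fin.
- by move=> j; rewrite tnth_mktuple; case: ifPn => _; rewrite ?normrN normr1.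
apply: eq_integral => w _; rewrite -/(reflect _ _) -/r; congr (_ * _).
(* At coordinate [i] the reflected [w] gives [x_i + r(w)_i = -(y_i + w_i)]; the sign is absorbed by
   the evenness of [F]. *)
apply: evF => j; rewrite [tnth (vadd x _) j]tnth_mktuple.
rewrite [tnth (vadd y _) j]tnth_mktuple /r reflectE.
case: eqVneq => [->|ji]; last by rewrite xy.
by rewrite -normrN; congr `|_|%R; lra.
Qed.

Lemma correlation_step x y i :
    (forall u v, (forall j, `|tnth u j| = `|tnth v j|)%R -> F u = F v) ->
    (forall j, j != i -> tnth x j = tnth y j) ->
    (forall w w', (forall j, tnth w' j =
        if j == i then - tnth x i - tnth y i - tnth w i else tnth w j)%R ->
      F (vadd y w) * (G w)%:E + F (vadd x w) * (G w')%:E <=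
      F (vadd x w) * (G w)%:E + F (vadd y w) * (G w')%:E) ->
  correlation F G y <= correlation F G x.
Proof.
move=> evF xy le.
suff : correlation F G y + correlation F G y <= correlation F G x + correlation F G x.
  (* Halving an inequality between extended reals: a strict reverse inequality could be added to
     itself. *)
  by apply: contraTT; rewrite -!ltNge => h; exact: lteD.
rewrite (correlation2E evF xy) (@correlation2E y x i)//; last first.
  by move=> j /xy.
have mr a : measurable_fun setT (reflect i a) by exact: measurable_vaff.
have mFr u v a : measurable_fun setT (fun w => F (vadd u w) * (G w)%:E
    + F (vadd v w) * (G (reflect i a w))%:E).
  apply: emeasurable_funD => //.
  apply: emeasurable_funM; last by apply/measurable_EFinP; exact: measurableT_comp.
  exact: (measurableT_comp mF (measurable_vaddl v)).
apply: ge0_le_integral => //.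
- by move=> w _; rewrite adde_ge0 ?mule_ge0 ?lee_fin.
move=> w _; rewrite [(- tnth y i - _)%R]addrC; apply: le => j.
by rewrite reflectE; case: eqVneq => // ->.
Qed.

End correlation_step.

(** By [abs_le_reflect], the values of [F] at [x + w] and [y + w] are ordered in the same way as
    those of [G] at [w] and its reflection, so pairing large with large gives the larger sum. *)
Lemma solid_correlation F G : measurable_fun setT F -> (forall x, 0 <= F x) ->
  measurable_fun setT G -> (forall x, (0 <= G x)%R) -> solid F -> solid (EFin \o G) ->
  solid (correlation F G).
Proof.
move=> mF F0 mG G0 sF sG.
apply: (@coordinatewise_abs_le (fun x y => correlation F G y <= correlation F G x)).
- by [].
- by move=> y x z xy yz; exact: le_trans xy.
move=> x y i xy xyi; apply: (correlation_step mF F0 mG G0 (i := i)) => // [u v uv|w w' ww'].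
  by apply/le_anti/andP; split; apply: sF => j; rewrite uv.
case: (abs_le_reflect (tnth w i) xyi) => [[h1 h2]|[h1 h2]].
- apply: lee_rearrangement => //.
  + apply: sF => j; rewrite !tnth_mktuple.
    by have [->//|ji] := eqVneq j i; rewrite xy.
  + rewrite -lee_fin; apply: sG => j; rewrite ww'.
    by have [->//|ji] := eqVneq j i.
- rewrite addeC [leRHS]addeC; apply: lee_rearrangement => //.
  + apply: sF => j; rewrite !tnth_mktuple.
    by have [->//|ji] := eqVneq j i; rewrite xy.
  + rewrite -lee_fin; apply: sG => j; rewrite ww'.
    by have [->//|ji] := eqVneq j i.
Qed.

(** The same pairing with [x] and [y] exchanged. Negating [F] would not reduce this to the solid
    case, since the integrands must stay nonnegative. *)
Lemma antisolid_correlation F G : measurable_fun setT F -> (forall x, 0 <= F x) ->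
  measurable_fun setT G -> (forall x, (0 <= G x)%R) -> antisolid F -> solid (EFin \o G) ->
  antisolid (correlation F G).
Proof.
move=> mF F0 mG G0 sF sG.
apply: (@coordinatewise_abs_le (fun x y => correlation F G x <= correlation F G y)).
- by [].
- by move=> y x z; exact: le_trans.
move=> x y i xy xyi.
apply: (correlation_step mF F0 mG G0 (i := i)) => // [u v uv|j /xy//|w w' ww'].
  by apply/le_anti/andP; split; apply: sF => j; rewrite uv.
case: (abs_le_reflect (tnth w i) xyi) => [[h1 h2]|[h1 h2]].
- apply: lee_rearrangement => //.
  + apply: sF => j; rewrite !tnth_mktuple.
    by have [->//|ji] := eqVneq j i; rewrite xy.
  + rewrite -lee_fin; apply: sG => j; rewrite ww'.
    by have [->|ji//] := eqVneq j i; rewrite [(- tnth y i - _)%R]addrC.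
- rewrite addeC [leRHS]addeC; apply: lee_rearrangement => //.
  + apply: sF => j; rewrite !tnth_mktuple.
    by have [->//|ji] := eqVneq j i; rewrite xy.
  + rewrite -lee_fin; apply: sG => j; rewrite ww'.
    by have [->|ji//] := eqVneq j i; rewrite [(- tnth y i - _)%R]addrC.
Qed.

End solid_functions.

(** * Densities of random vectors *)

Section solid_density.
Context {R : realType} {d : nat} {disp : measure_display}
  {Omega : measurableType disp} (P : probability Omega R).
Local Open Scope ereal_scope.
Implicit Types (X : Omega -> d.-tuple R) (f g : d.-tuple R -> R).

Lemma density_integrable X f : has_density P X f ->
  (lebesgue_tuple d).-integrable setT (EFin \o f).
Proof.
move=> [mX mf f0 fE]; apply/integrableP; split; first exact/measurable_EFinP.
under eq_integral do rewrite /= ger0_norm//.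
rewrite -fE// /pushforward preimage_setT.
by rewrite probability_setT ltry.
Qed.

Lemma density_ae_eq X f g : has_density P X f -> has_density P X g ->
  ae_eq (lebesgue_tuple d) setT (EFin \o f) (EFin \o g).
Proof.
move=> df dg; apply: integral_ae_eq => //.
- exact: density_integrable df.
- by case: dg => _ mg _ _; exact/measurable_EFinP.
- move=> A _ mA; case: df => _ _ _ fE; case: dg => _ _ _ gE.
  by rewrite /comp -fE// -gE.
Qed.

Lemma has_density_ae_eq X f g : has_density P X f -> measurable_fun setT g ->
  (forall x, 0 <= g x)%R ->
  ae_eq (lebesgue_tuple d) setT (EFin \o f) (EFin \o g) -> has_density P X g.
Proof.
move=> [mX mf f0 fE] mg g0 fg; split=> // A mA; rewrite fE//.
apply: ae_eq_integral => //.
- exact/measurable_funTS/measurable_EFinP.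
- exact/measurable_funTS/measurable_EFinP.
- exact: ae_eq_subset fg.
Qed.

(** For [c > 0], the superlevel set of [f] at [c] is the sublevel set of the convex function [phi]
    at [- ln c]. *)
Lemma log_concave_quasiconcave f (phi : d.-tuple R -> \bar R) :
  convex_ereal phi -> (forall x, (f x)%:E = expeR (- phi x)) ->
  forall x y a c, (0 <= a <= 1)%R -> (c <= f x)%R -> (c <= f y)%R ->
    (c <= f (vadd (vscale a x) (vscale (1 - a) y)))%R.
Proof.
move=> [phiNy cphi] fE x y a c a01 cx cy.
have [c0|c0] := leP c 0%R.
  by rewrite (le_trans c0)// -lee_fin fE expeR_ge0.
have cE z : (c <= f z)%R = (phi z <= (- ln c)%:E).
  rewrite -lee_fin fE; have := phiNy z; case: (phi z) => [r| |]//= _.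
  - by rewrite !lee_fin lerNr -{1}(lnK (x := c)) ?posrE// ler_expR.
  - by rewrite leye_eq lee_fin leNgt c0.
move: cx cy; rewrite !cE => cx cy; apply: le_trans (cphi x y a a01) _.
have /andP[a0 a1] := a01.
apply: (@le_trans _ _ (a%:E * (- ln c)%:E + (1 - a)%:E * (- ln c)%:E)).
  by apply: leeD; apply: lee_wpmul2l => //; rewrite lee_fin; lra.
by rewrite -!EFinM -EFinD lee_fin; nra.
Qed.

Lemma vflipK s : involutive (@vflip R d s).
Proof.
move=> x; apply/eq_from_tnth => i; rewrite !tnth_mktuple.
by case: (s i); rewrite ?expr1 ?expr0; lra.
Qed.

Lemma vflipE s (x : d.-tuple R) :
  vflip s x = vaff [tuple ((-1) ^+ s i)%R | i < d] [tuple 0%R | i < d] x.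
Proof. by apply/eq_from_tnth => i; rewrite !tnth_mktuple addr0. Qed.

Lemma measurable_vflip s : measurable_fun setT (@vflip R d s).
Proof.
rewrite (_ : vflip s = vaff [tuple ((-1) ^+ s i)%R | i < d] [tuple 0%R | i < d]).
  exact: measurable_vaff.
by apply/funext => x; exact: vflipE.
Qed.

Lemma unconditional_density_flip X f s : unconditional P X -> has_density P X f ->
  has_density P X (f \o vflip s).
Proof.
move=> uX [mX mf f0 fE]; split=> //.
- by apply: measurableT_comp => //; exact: measurable_vflip.
- by move=> x; exact: f0.
move=> A mA; have mB : measurable (vflip s @^-1` A).
  by rewrite -[X in measurable X]setTI; exact: measurable_vflip.
rewrite -(uX s)// (_ : pushforward _ _ _ = pushforward P X (vflip s @^-1` A))//.
rewrite fE// integral_mkcond [RHS]integral_mkcond.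
set F := _ \_ _.
rewrite -(@ge0_integral_isometry _ _ [tuple ((-1) ^+ s i)%R | i < d]
  [tuple 0%R | i < d] F); last 3 first.
- by move=> i; rewrite tnth_mktuple normrX normrN1 expr1n.
- apply/(measurable_restrictT _ _).1 => //.
  exact/measurable_funTS/measurable_EFinP.
- by move=> x; rewrite /F patchE; case: ifPn => // _; rewrite lee_fin.
apply: eq_integral => x _; rewrite -vflipE /F !patchE/=.
have -> // : (vflip s x \in vflip s @^-1` A) = (x \in A).
by apply/idP/idP; rewrite !inE/= vflipK.
Qed.

Lemma log_concave_solid_density X : unconditional P X -> log_concave P X ->
  exists2 f, has_density P X f & solid (EFin \o f).
Proof.
(* The given density is only a.e. invariant under flips; the minimum over all
   flips is invariant everywhere and still quasi-concave. *)
move=> uX [f [phi [df cphi fE]]].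
have f0 : forall x, (0 <= f x)%R by case: df.
pose g x := (\big[Order.min/f x]_(s : {ffun 'I_d -> bool}) f (vflip s x))%R.
(* The default [f x] of the minimum is the value at the trivial flip, so it adds no constraint. *)
have gP c x : (c <= g x)%R <-> forall s, (c <= f (vflip s x))%R.
  split=> [/bigmin_geP[_ h] s|h]; first exact: h.
  apply/bigmin_geP; split => [|s _]; last exact: h.
  rewrite (_ : x = vflip [ffun => false] x)//.
  by apply/eq_from_tnth => i; rewrite tnth_mktuple ffunE expr0 mul1r.
exists g.
  (* An arbitrary list of flips allows induction; each flip of [f] is again a density of [X], hence
     a.e. equal to [f]. *)
  have : forall l : seq {ffun 'I_d -> bool}, let g_ := fun x =>
      (\big[Order.min/f x]_(s <- l) f (vflip s x))%R in
      measurable_fun setT g_ /\ ae_eq (lebesgue_tuple d) setT (EFin \o f) (EFin \o g_).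
    elim => [|s l [IHm IHe]] /=.
      split; first by under eq_fun do rewrite big_nil; case: df.
      by apply: aeW => x _ /=; rewrite big_nil.
    have dfs := unconditional_density_flip s uX df.
    split.
      under eq_fun do rewrite big_cons.
      by apply: measurable_minr => //; case: dfs.
    have := density_ae_eq df dfs.
    apply: filterS2 IHe => x /= h1 h2 _.
    have [{}h1] := h1 I; have [{}h2] := h2 I.
    by rewrite big_cons -h1 -h2 minxx.
  move=> /(_ (index_enum _))[mg eg].
  apply: has_density_ae_eq df mg _ eg => x.
  by apply/gP => s.
apply: (@coordinatewise_abs_le _ _ (fun x y => (EFin \o g) y <= (EFin \o g) x)).
- by [].
- by move=> y x z xy yz; exact: le_trans xy.
move=> x y i xy xyi; rewrite lee_fin; apply/gP => s.
have /gP gy := lexx (g y).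
(* The point [x] lies on the segment between [y] and its reflection in coordinate [i]: the weight
   [a] solves [a y_i - (1 - a) y_i = x_i]. The flip [s'] is [s] composed with that reflection. *)
pose s' : {ffun 'I_d -> bool} := [ffun j => s j (+) (j == i)].
pose a := (2^-1 * (1 + tnth x i / tnth y i))%R.
have [y0|y0] := eqVneq (tnth y i) 0%R.
  rewrite (_ : x = y)//; apply/eq_from_tnth => j.
  have [->|/xy//] := eqVneq j i.
  by move: xyi; rewrite y0 normr0 normr_le0 => /eqP.
have : (`|tnth x i / tnth y i| <= 1)%R.
  by rewrite normrM normfV ler_pdivrMr ?normr_gt0// mul1r.
rewrite ler_norml => /andP[? ?].
have a01 : (0 <= a <= 1)%R by rewrite /a; apply/andP; split; lra.
have := log_concave_quasiconcave cphi fE a01 (gy s) (gy s').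
congr (_ <= f _)%R; apply/eq_from_tnth => j; rewrite !tnth_mktuple ffunE.
have [->|ji] := eqVneq j i.
  rewrite addbT; case: (s i); rewrite /= ?expr0 ?expr1 /a; field; exact: y0.
by rewrite addbF xy//; ring.
Qed.

End solid_density.

(** * Expectations as integrals against densities *)

Section density_integrals.
Context {R : realType} {d : nat} {disp : measure_display}
  {Omega : measurableType disp} (P : probability Omega R).
Local Open Scope ereal_scope.

(** The law of [X] is absolutely continuous, and [f] agrees a.e. with its Radon-Nikodym derivative,
    for which the change of variables holds. *)
Lemma ge0_integral_density (X : Omega -> d.-tuple R) (f : d.-tuple R -> R)
    (F : d.-tuple R -> \bar R) : has_density P X f ->
  measurable_fun setT F -> (forall x, 0 <= F x) ->
  \int[P]_w F (X w) = \int[lebesgue_tuple d]_x (F x * (f x)%:E).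
Proof.
move=> df mF F0; have [mX mf f0 fE] := df.
pose Y : {RV P >-> d.-tuple R} := HB.pack X (isMeasurableFun.Build _ _ _ _ _ mX).
have Yac : distribution P Y `<< lebesgue_tuple d.
  apply/null_content_dominatesP => A mA A0.
  rewrite -[LHS]/(pushforward P X A) fE//; apply: null_set_integral => //.
  by apply/measurable_funTS/measurable_EFinP.
rewrite -[LHS](ge0_integral_distribution Y)//.
rewrite -(Radon_Nikodym_SigmaFinite.change_of_variables Yac)//.
have mg := measurable_int _ (Radon_Nikodym_SigmaFinite.f_integrable Yac).
apply: ae_eq_integral => //.
- exact: emeasurable_funM.
- by apply: emeasurable_funM => //; exact/measurable_EFinP.
have : ae_eq (lebesgue_tuple d) setT (EFin \o f)
    (Radon_Nikodym_SigmaFinite.f (distribution P Y) (lebesgue_tuple d)).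
  apply: integral_ae_eq => //; first exact: density_integrable df.
  move=> A _ mA; rewrite -Radon_Nikodym_SigmaFinite.f_integral//.
  by rewrite -[RHS]/(pushforward P X A) fE.
by apply: filterS => x /= /[apply] ->.
Qed.

(** Independence says that the joint law and the product of the two laws agree on rectangles, hence
    coincide; Tonelli's theorem then splits the integral. *)
Lemma ge0_integral_independent (X W : Omega -> d.-tuple R)
    (f g : d.-tuple R -> R) (F : d.-tuple R * d.-tuple R -> \bar R) :
  independent P X W -> has_density P X f -> has_density P W g ->
  measurable_fun setT F -> (forall x, 0 <= F x) ->
  \int[P]_w F (X w, W w) = \int[lebesgue_tuple d]_x
    (\int[lebesgue_tuple d]_y (F (x, y) * (g y)%:E) * (f x)%:E).
Proof.
move=> indep df dg mF F0; have [mX mf f0 fE] := df; have [mW mg g0 gE] := dg.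
pose X' : {RV P >-> d.-tuple R} := HB.pack X (isMeasurableFun.Build _ _ _ _ _ mX).
pose W' : {RV P >-> d.-tuple R} := HB.pack W (isMeasurableFun.Build _ _ _ _ _ mW).
have mXW : measurable_fun setT (fun w => (X w, W w)) by exact: measurable_fun_pair.
pose G x := \int[distribution P W']_y F (x, y).
have GE x : G x = \int[lebesgue_tuple d]_y (F (x, y) * (g y)%:E).
  rewrite /G ge0_integral_distribution//; last first.
    by apply: (measurableT_comp mF); exact: pair1_measurable.
  rewrite -(ge0_integral_density (X := W) (F := fun y => F (x, y)))//.
  by apply: (measurableT_comp mF); exact: pair1_measurable.
have mG : measurable_fun setT G.
  exact: (@measurable_fun_fubini_tonelli_F _ _ _ _ _ (distribution P W') F).
under [RHS]eq_integral do rewrite -GE.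
rewrite -(ge0_integral_density df)//; last by move=> x; exact: integral_ge0.
transitivity (\int[distribution P X']_x G x); last first.
  by rewrite (ge0_integral_distribution X')// => x; exact: integral_ge0.
rewrite -(@fubini_tonelli1 _ _ _ _ _ (distribution P X') (distribution P W'))//.
rewrite -[LHS](@ge0_integral_pushforward _ _ _ _ _ _ mXW P setT F)//.
apply: eq_measure_integral => A mA _; apply/esym.
by apply: (@product_measure_unique _ _ _ _ _ (distribution P X') (distribution P W')
  (measure_pushforward P mXW)).
Qed.

End density_integrals.

(** * Density of T(X) + W *)

Section convolution.
Context {R : realType} {d : nat}.
Local Open Scope ereal_scope.
Implicit Types (T : d.-tuple R -> d.-tuple R) (f g : d.-tuple R -> R).

Definition vsub (x y : d.-tuple R) : d.-tuple R :=
  [tuple (tnth x i - tnth y i)%R | i < d].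

Lemma measurable_vadd2 (disp : measure_display) (U : measurableType disp)
    (a b : U -> d.-tuple R) : measurable_fun setT a -> measurable_fun setT b ->
  measurable_fun setT (fun u => vadd (a u) (b u)).
Proof.
move=> ma mb; apply: measurable_tuple_of => i; apply: measurable_funD.
  exact: (measurableT_comp (measurable_tnth i)).
exact: (measurableT_comp (measurable_tnth i)).
Qed.

Lemma measurable_vsub2 (disp : measure_display) (U : measurableType disp)
    (a b : U -> d.-tuple R) : measurable_fun setT a -> measurable_fun setT b ->
  measurable_fun setT (fun u => vsub (a u) (b u)).
Proof.
move=> ma mb; apply: measurable_tuple_of => i; apply: measurable_funB.
  exact: (measurableT_comp (measurable_tnth i)).
exact: (measurableT_comp (measurable_tnth i)).
Qed.

Lemma ge0_integral_vsub (y : d.-tuple R) (F : d.-tuple R -> \bar R) :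
  measurable_fun setT F -> (forall x, 0 <= F x) ->
  \int[lebesgue_tuple d]_x F (vsub x y) = \int[lebesgue_tuple d]_x F x.
Proof.
move=> mF F0.
rewrite -[RHS](@ge0_integral_isometry _ _ [tuple 1%R | i < d]
  [tuple (- tnth y i)%R | i < d])//; last by move=> i; rewrite tnth_mktuple normr1.
apply: eq_integral => x _; congr F; apply/eq_from_tnth => i.
by rewrite !tnth_mktuple mul1r.
Qed.

(** Points with the same [i]-th coordinate have images with the same [i]-th coordinate, so that
    [T(x)_i = tau(x_i)] with [tau] 1-Lipschitz, hence continuous. *)
Lemma measurable_strong_contraction T : strong_contraction T -> measurable_fun setT T.
Proof.
move=> cT; apply/measurable_fun_tnthP => i.
pose tau (t : R) : R := tnth (T [tuple t | _ < d]) i.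
rewrite (_ : _ \o _ = tau \o (fun x : d.-tuple R => tnth x i)); last first.
  apply/funext => x /=; apply/eqP; rewrite -subr_eq0 -normr_le0.
  by apply: le_trans (cT _ _ _) _; rewrite tnth_mktuple subrr normr0.
apply: measurableT_comp; last exact: measurable_tnth.
apply: continuous_measurable_fun => t; apply/cvgrPdist_lt => e e0.
near=> s; apply: le_lt_trans (cT _ _ _) _; rewrite !tnth_mktuple.
near: s; exact: cvgr_dist_lt.
Unshelve. all: by end_near. Qed.

(** The integral runs over the values of [X] and not of [T(X)], because [T(X)] need not have a
    density. *)
Definition convolution T f g z :=
  \int[lebesgue_tuple d]_x (g (vsub z (T x)) * f x)%:E.

Section convolution_theory.
Variables (T : d.-tuple R -> d.-tuple R) (f g : d.-tuple R -> R).
Hypotheses (mT : measurable_fun setT T).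
Hypotheses (mf : measurable_fun setT f) (f0 : forall x, (0 <= f x)%R).
Hypotheses (mg : measurable_fun setT g) (g0 : forall x, (0 <= g x)%R).

Let mk : measurable_fun setT (fun p : d.-tuple R * d.-tuple R =>
  (g (vsub p.1 (T p.2)) * f p.2)%:E).
Proof.
apply/measurable_EFinP/measurable_funM; last exact: measurableT_comp.
apply: (measurableT_comp mg); apply: measurable_vsub2 => //.
exact: measurableT_comp.
Qed.

Let mk1 z : measurable_fun setT (fun x => (g (vsub z (T x)) * f x)%:E).
Proof. exact: (measurableT_comp mk (pair1_measurable z)). Qed.

Let k0 (p : d.-tuple R * d.-tuple R) : 0 <= (g (vsub p.1 (T p.2)) * f p.2)%:E.
Proof. by rewrite lee_fin mulr_ge0. Qed.

Lemma measurable_convolution : measurable_fun setT (convolution T f g).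
Proof.
exact: (@measurable_fun_fubini_tonelli_F _ _ _ _ _ (lebesgue_tuple d) _ mk k0).
Qed.

Lemma convolution_ge0 z : 0 <= convolution T f g z.
Proof. by apply: integral_ge0 => x _; exact: (k0 (z, x)). Qed.

Lemma convolution_le (M : R) z : (forall x, (g x <= M)%R) ->
  \int[lebesgue_tuple d]_x (f x)%:E = 1 -> convolution T f g z <= M%:E.
Proof.
move=> gM f1; have M0 : (0 <= M)%R by exact: le_trans (gM z).
rewrite -[leRHS]mule1 -f1 -ge0_integralZl//; last 2 first.
  exact/measurable_EFinP.
  by move=> x _; rewrite lee_fin.
apply: ge0_le_integral => //.
- by move=> x _; exact: (k0 (z, x)).
- by apply: emeasurable_funM => //; exact/measurable_EFinP.
- by move=> x _; rewrite -EFinM lee_fin ler_wpM2r.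
Qed.

(** For fixed [x], translation invariance allows the substitution [z = T x + w] in the inner
    integral; Tonelli's theorem then moves the integral over [z] outside. The hypothesis on [h]
    makes the convolution finite everywhere. *)
Lemma has_density_convolution disp (Omega : measurableType disp)
    (P : probability Omega R) (X W : Omega -> d.-tuple R) (h : d.-tuple R -> R) :
  independent P X W -> has_density P X f -> has_density P W g ->
  (forall z, (h z)%:E = convolution T f g z) ->
  has_density P (fun w => vadd (T (X w)) (W w)) h.
Proof.
move=> indep df dg hE; have [mX _ _ _] := df; have [mW _ _ _] := dg.
have mTX : measurable_fun setT (T \o X) by exact: measurableT_comp.
have mS : measurable_fun setT (fun w => vadd (T (X w)) (W w)).
  exact: measurable_vadd2.
split=> // [|z|A mA].
- apply/measurable_EFinP; rewrite (_ : EFin \o h = convolution T f g).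
    exact: measurable_convolution.
  by apply/funext => z; rewrite /= hE.
- by rewrite -lee_fin hE convolution_ge0.
have mB : measurable ((fun w => vadd (T (X w)) (W w)) @^-1` A).
  by rewrite -[X in measurable X]setTI; exact: mS.
rewrite /pushforward -(setIT (_ @^-1` _)) -integral_indic//.
have mI disp' (U : measurableType disp') (a : U -> d.-tuple R) :
    measurable_fun setT a -> measurable_fun setT (fun u => (\1_A (a u))%:E : \bar R).
  move=> ma; apply/measurable_EFinP.
  exact: (measurableT_comp (measurable_indic mA)).
rewrite (@ge0_integral_independent _ _ _ _ P X W f g
   (fun p => (\1_A (vadd (T p.1) p.2))%:E))//; last first.
  apply: mI; apply: measurable_vadd2 => //.
  exact: measurableT_comp.
transitivity (\int[lebesgue_tuple d]_x \int[lebesgue_tuple d]_z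
    ((\1_A z)%:E * (g (vsub z (T x)) * f x)%:E)).
  apply: eq_integral => x _ /=.
  rewrite -(@ge0_integral_vsub (T x)); last 2 first.
  - apply: emeasurable_funM; last exact/measurable_EFinP.
    apply: mI; exact: measurable_vaddl.
  - by move=> w; rewrite mule_ge0// lee_fin.
  rewrite -ge0_integralZr//; last 3 first.
  - apply: emeasurable_funM; last first.
      apply/measurable_EFinP; apply: (measurableT_comp mg).
      exact: measurable_vsub2.
    apply: mI; apply: measurable_vadd2 => //.
    exact: measurable_vsub2.
  - by move=> w _; rewrite mule_ge0// lee_fin.
  - by rewrite lee_fin.
  apply: eq_integral => z _; rewrite -muleA; congr (_ * _).
  congr (\1_A _)%:E; apply/eq_from_tnth => i.
  by rewrite !tnth_mktuple addrC subrK.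
rewrite -(@fubini_tonelli _ _ _ _ _ (lebesgue_tuple d) (lebesgue_tuple d)
  (fun p => (\1_A p.1)%:E * (g (vsub p.1 (T p.2)) * f p.2)%:E))//; last 2 first.
- apply: emeasurable_funM => //.
  exact: mI.
- by move=> p; rewrite mule_ge0// lee_fin.
rewrite [RHS]integral_mkcond; apply: eq_integral => z _.
rewrite patchE/= ge0_integralZl//; last first.
  by move=> x _; exact: (k0 (z, x)).
rewrite -/(convolution T f g z) -hE indicE.
by case: ifPn => _; rewrite ?mul1e ?mul0e.
Qed.

End convolution_theory.

(** As [g] is even in each coordinate, the convolution at [z] is the correlation of [g] with [f] at
    [-z]. *)
Lemma solid_convolution f g : measurable_fun setT f -> (forall x, (0 <= f x)%R) ->
  measurable_fun setT g -> (forall x, (0 <= g x)%R) ->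
  solid (EFin \o f) -> solid (EFin \o g) -> solid (convolution id f g).
Proof.
move=> mf f0 mg g0 sf sg.
have sc : solid (correlation (EFin \o g) f).
  by apply: solid_correlation => //; exact/measurable_EFinP.
pose opp (x : d.-tuple R) : d.-tuple R := [tuple (- tnth x i)%R | i < d].
have cE z : convolution id f g z = correlation (EFin \o g) f (opp z).
  apply: eq_integral => x _; rewrite EFinM; congr (_ * _).
  have e (a b : R) : (`|- a + b| = `|a - b|)%R by rewrite -normrN opprD opprK.
  by apply/le_anti/andP; split; apply: sg => i; rewrite !tnth_mktuple e.
move=> x y xy; rewrite !cE; apply: sc => i.
by rewrite !tnth_mktuple !normrN.
Qed.

End convolution.

(** * Effect of a strong contraction on expectations *)

Section contraction_comparison.
Context {R : realType} {d : nat} {disp : measure_display}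
  {Omega : measurableType disp} (P : probability Omega R).
Local Open Scope ereal_scope.
Variables (X W : Omega -> d.-tuple R) (T : d.-tuple R -> d.-tuple R).
Variables (fX fW : d.-tuple R -> R).
Hypotheses (indepXW : independent P X W).
Hypotheses (dX : has_density P X fX) (dW : has_density P W fW).
Hypotheses (sW : solid (EFin \o fW)) (cT : strong_contraction T).

Let mX : measurable_fun setT X. Proof. by case: dX. Qed.
Let mW : measurable_fun setT W. Proof. by case: dW. Qed.
Let mfX : measurable_fun setT fX. Proof. by case: dX. Qed.
Let mfW : measurable_fun setT fW. Proof. by case: dW. Qed.
Let fX0 x : (0 <= fX x)%R. Proof. by case: dX. Qed.
Let fW0 x : (0 <= fW x)%R. Proof. by case: dW. Qed.
Let mT : measurable_fun setT T. Proof. exact: measurable_strong_contraction. Qed.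

Let T0 := T [tuple 0%R | i < d].

Lemma measurable_correlation (F : d.-tuple R -> \bar R) (U : d.-tuple R -> d.-tuple R) :
  measurable_fun setT F -> (forall x, 0 <= F x) -> measurable_fun setT U ->
  measurable_fun setT (fun x => correlation F fW (U x) * (fX x)%:E).
Proof.
move=> mF F0 mU; apply: emeasurable_funM; last exact/measurable_EFinP.
apply: (@measurable_fun_fubini_tonelli_F _ _ _ _ _ (lebesgue_tuple d)
  (fun p : d.-tuple R * d.-tuple R => F (vadd (U p.1) p.2) * (fW p.2)%:E)).
  apply: emeasurable_funM.
    apply: (measurableT_comp mF); apply: measurable_vadd2 => //.
    exact: measurableT_comp.
  by apply/measurable_EFinP; exact: measurableT_comp.
by move=> p; rewrite mule_ge0// lee_fin.
Qed.

Lemma integral_vadd_correlation (F : d.-tuple R -> \bar R) (U : d.-tuple R -> d.-tuple R) :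
  measurable_fun setT F -> (forall x, 0 <= F x) -> measurable_fun setT U ->
  \int[P]_w F (vadd (U (X w)) (W w)) =
  \int[lebesgue_tuple d]_x (correlation F fW (U x) * (fX x)%:E).
Proof.
move=> mF F0 mU.
rewrite (ge0_integral_independent (F := fun p => F (vadd (U p.1) p.2)) indepXW dX dW)//.
apply: (measurableT_comp mF); apply: measurable_vadd2 => //.
exact: measurableT_comp.
Qed.

Let mTT : measurable_fun setT (fun x => vsub (T x) T0).
Proof. exact: measurable_vsub2. Qed.

Let vsub_vadd x w : vsub (vadd (T x) w) T0 = vadd (vsub (T x) T0) w.
Proof. by apply/eq_from_tnth => i; rewrite !tnth_mktuple addrAC. Qed.

Let contraction_abs x i : (`|tnth (vsub (T x) T0) i| <= `|tnth x i|)%R.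
Proof.
by rewrite tnth_mktuple (le_trans (cT _ _ _))// tnth_mktuple subr0.
Qed.

(** Conditionally on [X = x], the two sides are correlations with the density of [W] at [x] and at
    [T x - T 0], and the second point has the smaller coordinates in absolute value. *)
Lemma solid_contraction_le (F : d.-tuple R -> \bar R) :
  measurable_fun setT F -> (forall x, 0 <= F x) -> solid F ->
  \int[P]_w F (vadd (X w) (W w)) <=
  \int[P]_w F (vsub (vadd (T (X w)) (W w)) T0).
Proof.
move=> mF F0 sF.
under [leRHS]eq_integral do rewrite vsub_vadd.
rewrite (@integral_vadd_correlation F id)//.
rewrite (@integral_vadd_correlation F (fun x => vsub (T x) T0))//.
have c0 x : 0 <= correlation F fW x.
  by apply: integral_ge0 => w _; rewrite mule_ge0// lee_fin.
apply: ge0_le_integral => //.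
- by move=> x _; rewrite mule_ge0// lee_fin.
- exact: measurable_correlation.
- exact: measurable_correlation.
- move=> x _; apply: lee_wpmul2r; first by rewrite lee_fin.
  by apply: solid_correlation => // i; exact: contraction_abs.
Qed.

Lemma antisolid_contraction_le (F : d.-tuple R -> \bar R) :
  measurable_fun setT F -> (forall x, 0 <= F x) -> antisolid F ->
  \int[P]_w F (vsub (vadd (T (X w)) (W w)) T0) <=
  \int[P]_w F (vadd (X w) (W w)).
Proof.
move=> mF F0 sF.
under eq_integral do rewrite vsub_vadd.
rewrite (@integral_vadd_correlation F (fun x => vsub (T x) T0))//.
rewrite (@integral_vadd_correlation F id)//.
have c0 x : 0 <= correlation F fW x.
  by apply: integral_ge0 => w _; rewrite mule_ge0// lee_fin.
apply: ge0_le_integral => //.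
- by move=> x _; rewrite mule_ge0// lee_fin.
- exact: measurable_correlation.
- exact: measurable_correlation.
- move=> x _; apply: lee_wpmul2r; first by rewrite lee_fin.
  by apply: antisolid_correlation => // i; exact: contraction_abs.
Qed.

End contraction_comparison.

(** * Integral comparisons for convex functions of a density *)

Section tangent_inequalities.
Context {R : realType}.
Implicit Types a b al : R.

(** Young's inequality for [a] and [b^(al - 1)] with exponents [al] and [al/(al - 1)]. *)
Lemma powR_tangent_ge a b al : 1 < al -> 0 <= a -> 0 <= b ->
  al * (b `^ (al - 1) * a) <= a `^ al + (al - 1) * b `^ al.
Proof.
move=> al1 a0 b0; have alB : 0 < al - 1 by lra.
have al0 : 0 < al by lra.
have := @conjugate_powR _ a (b `^ (al - 1)) al (al / (al - 1)) a0 (powR_ge0 _ _) al0.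
rewrite -powRrM (_ : (al - 1) * (al / (al - 1)) = al); last by field; lra.
have -> : b `^ al / (al / (al - 1)) = (al - 1) * b `^ al / al by field; lra.
move=> /(_ (divr_gt0 al0 alB)) h.
have : a * b `^ (al - 1) <= a `^ al / al + (al - 1) * b `^ al / al.
  by apply: h; field; lra.
by rewrite -mulrDl ler_pdivlMr// => h'; lra.
Qed.

(** Young's inequality with exponents [1/al] and [1/(1 - al)], for the factors [(b^(al-1) a)^al] and
    [(b^al)^(1-al)], whose product is [a^al]. *)
Lemma powR_tangent_le a b al : 0 < al < 1 -> 0 <= a -> 0 < b ->
  a `^ al <= (1 - al) * b `^ al + al * (b `^ (al - 1) * a).
Proof.
move=> /andP[al0 al1] a0 b0; have alB : 0 < 1 - al by lra.
have ba0 : 0 <= b `^ (al - 1) * a by rewrite mulr_ge0// powR_ge0.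
have := @conjugate_powR _ ((b `^ (al - 1) * a) `^ al) ((b `^ al) `^ (1 - al)) al^-1 (1 - al)^-1
  (powR_ge0 _ _) (powR_ge0 _ _).
rewrite !invr_gt0 !invrK => /(_ al0 alB (subrKC _ _)).
rewrite -[_ `^ al `^ al^-1]powRrM -[_ `^ (1 - al) `^ (1 - al)^-1]powRrM !divff; last 2 first.
- by rewrite gt_eqF.
- by rewrite gt_eqF.
rewrite !powRr1 ?powR_ge0// powRM ?powR_ge0// -!powRrM mulrAC -powRD; last first.
  by apply/implyP => _; rewrite gt_eqF.
rewrite (_ : (al - 1) * al + al * (1 - al) = 0); last by ring.
by rewrite powRr0 mul1r; lra.
Qed.

(** This is [ln u <= u - 1] at [u = b/a]. Integrated over two densities it becomes the Gibbs
    inequality. *)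
Lemma ln_tangent a b : 0 < a -> 0 < b -> a * (ln b - ln a) <= b - a.
Proof.
move=> a0 b0; rewrite -ln_div ?posrE//.
have := @le_ln1Dx R (b / a - 1); rewrite addrCA subrr addr0 => h.
have {}h : ln (b / a) <= b / a - 1.
  by apply: h; have := divr_gt0 b0 a0; lra.
apply: (@le_trans _ _ (a * (b / a - 1))); first by rewrite ler_pM2l.
by rewrite le_eqVlt; apply/orP; left; apply/eqP; field; lra.
Qed.

End tangent_inequalities.

Section integral_xlnx.
Context d (T : measurableType d) (R : realType) (mu : {measure set T -> \bar R}).
Local Open Scope ereal_scope.
Variables (f : T -> R) (M : R).
Hypotheses (mf : measurable_fun setT f) (f0 : forall x, (0 <= f x)%R).
Hypotheses (f1 : \int[mu]_x (f x)%:E = 1) (M1 : (1 <= M)%R)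
  (fM : forall x, (f x <= M)%R).

Lemma xlnx_gap_ge0 x : (0 <= f x * (ln M - ln (f x)))%R.
Proof.
rewrite mulr_ge0//; have [fx|fx] := leP (f x) 0%R.
  by rewrite (ln0 fx) subr0 ln_ge0.
by rewrite subr_ge0 ler_ln ?posrE//; exact: lt_le_trans (fM x).
Qed.

Lemma measurable_xlnx_gap :
  measurable_fun setT (fun x => (f x * (ln M - ln (f x)))%:E : \bar R).
Proof.
apply/measurable_EFinP/measurable_funM => //; apply: measurable_funB => //.
by apply: measurableT_comp => //; exact: measurable_ln.
Qed.

(* Stated with the nonnegative integrand f (ln M - ln f) on the right, so that
   the identity also holds when both sides are infinite. *)
Lemma integral_xlnx : \int[mu]_x (f x * ln (f x))%:E =
  (ln M)%:E - \int[mu]_x (f x * (ln M - ln (f x)))%:E.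
Proof.
have A0 := xlnx_gap_ge0; have mA := measurable_xlnx_gap.
have lnM0 : (0 <= ln M)%R by rewrite ln_ge0.
pose h x := (f x * ln (f x))%:E.
have mh : measurable_fun setT h.
  apply/measurable_EFinP/measurable_funM => //.
  by apply: measurableT_comp => //; exact: measurable_ln.
have lnME : \int[mu]_x (f x * ln M)%:E = (ln M)%:E.
  under eq_integral do rewrite mulrC EFinM.
  rewrite ge0_integralZl ?f1 ?mule1//; first exact/measurable_EFinP.
  by move=> x _; rewrite lee_fin.
have mfl : measurable_fun setT (fun x => (f x * ln M)%:E : \bar R).
  by apply/measurable_EFinP/measurable_funM.
have -> : \int[mu]_x (f x * ln (f x))%:E = \int[mu]_x h^\+ x - \int[mu]_x h^\- x.
  by rewrite integralE.
have pE x : h^\+ x = (Order.max (f x * ln (f x)) 0)%:E by rewrite funeposE -EFin_max.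
have nE x : h^\- x = (Order.max (- (f x * ln (f x))) 0)%:E.
  by rewrite funenegE -EFinN -EFin_max.
have p0 : 0 <= \int[mu]_x h^\+ x by exact: integral_ge0.
have n0 : 0 <= \int[mu]_x h^\- x by exact: integral_ge0.
have a0 : 0 <= \int[mu]_x (f x * (ln M - ln (f x)))%:E.
  by apply: integral_ge0 => x _; rewrite lee_fin.
have pM : \int[mu]_x h^\+ x <= (ln M)%:E.
  rewrite -lnME; apply: ge0_le_integral => //.
  - exact: measurable_funepos.
  - move=> x _; rewrite pE lee_fin ge_max mulr_ge0// andbT.
    by have := A0 x; rewrite mulrBr subr_ge0.
(* Both sides are sums of nonnegative integrals, so no infinite quantities are subtracted; the
   positive part has a finite integral by [pM]. *)
have : \int[mu]_x h^\- x + (ln M)%:E =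
    \int[mu]_x (f x * (ln M - ln (f x)))%:E + \int[mu]_x h^\+ x.
  rewrite -{1}lnME -!ge0_integralD//.
  - apply: eq_integral => x _; rewrite pE nE -!EFinD mulrBr; congr EFin.
    by rewrite !maxEle; case: ifPn => ?; case: ifPn => ?; lra.
  - by move=> x _; rewrite lee_fin.
  - exact: measurable_funepos.
  - exact: measurable_funeneg.
  - by move=> x _; rewrite lee_fin mulr_ge0.
move: pM p0 n0 a0.
case: (\int[mu]_x h^\+ x) => [p| |]//=.
case: (\int[mu]_x h^\- x) => [n| |]//=;
  case: (\int[mu]_x (f x * (ln M - ln (f x)))%:E) => [a| |]//= _ _ _ _.
by rewrite -!EFinD => -[h']; congr EFin; lra.
Qed.

End integral_xlnx.

Section density_comparison.
Context d (T : measurableType d) (R : realType) (mu : {measure set T -> \bar R}).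
Local Open Scope ereal_scope.

Definition equidistributed (k f : T -> R) :=
  forall psi : R -> \bar R, measurable_fun setT psi ->
  (forall x, 0 <= psi x) -> \int[mu]_x psi (k x) = \int[mu]_x psi (f x).

(** In the application the two sides are the expectations of [phi(f(X + W))] and [phi(k(T(X) + W))].
    Monotonicity is asked on nonnegative arguments, where densities take their values. *)
Definition nondecreasing_comparison (f k g : T -> R) :=
  forall phi : R -> \bar R, measurable_fun setT phi -> (forall x, 0 <= phi x) ->
  (forall x y : R, (0 <= x)%R -> (x <= y)%R -> phi x <= phi y) ->
  \int[mu]_x (phi (f x) * (f x)%:E) <= \int[mu]_x (phi (k x) * (g x)%:E).

Definition nonincreasing_comparison (f k g : T -> R) :=
  forall phi : R -> \bar R, measurable_fun setT phi -> (forall x, 0 <= phi x) ->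
  (forall x y : R, (0 <= x)%R -> (x <= y)%R -> phi y <= phi x) ->
  \int[mu]_x (phi (k x) * (g x)%:E) <= \int[mu]_x (phi (f x) * (f x)%:E).

(* k plays the role of a translate of f aligned with the density g. *)
Variables f g k : T -> R.
Hypotheses (mf : measurable_fun setT f) (mg : measurable_fun setT g)
  (mk : measurable_fun setT k).
Hypotheses (f0 : forall x, (0 <= f x)%R) (g0 : forall x, (0 <= g x)%R)
  (k0 : forall x, (0 <= k x)%R).
Hypotheses (f1 : \int[mu]_x (f x)%:E = 1) (g1 : \int[mu]_x (g x)%:E = 1).
Hypotheses (kf : equidistributed k f)
  (fg_nondecreasing : nondecreasing_comparison f k g)
  (fg_nonincreasing : nonincreasing_comparison f k g).

(** The integral of [f] over [{f > t}] is the excess of [f] plus [t mu{f > t}], and the integral of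
    [g] over [{k > t}] is at most the excess of [g] plus [t mu{k > t}]. The two added terms are
    equal and finite, so they cancel. *)
Lemma excess_le (t : R) : (0 <= t)%R ->
  \int[mu]_x (Order.max (f x - t) 0)%:E <= \int[mu]_x (Order.max (g x - t) 0)%:E.
Proof.
move=> t0; pose phi (x : R) : R := ((t < x)%R)%:R.
have mphi : measurable_fun setT phi.
  apply: nondecreasing_measurable => // x y xy; rewrite /phi ler_nat.
  by case: (ltP t x) => // tx; rewrite (lt_le_trans tx xy).
have phi0 x : (0 <= phi x)%R by rewrite /phi ler0n.
have mphiE : measurable_fun setT (EFin \o phi) by exact/measurable_EFinP.
have mmax (h : T -> R) : measurable_fun setT h ->
    measurable_fun setT (fun x : T => (Order.max (h x - t) 0)%:E : \bar R).
  move=> mh; apply/measurable_EFinP; apply: measurable_maxr => //.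
  exact: measurable_funB.
have mt (h : T -> R) : measurable_fun setT h ->
    measurable_fun setT (fun x : T => (t * phi (h x))%:E : \bar R).
  move=> mh; apply/measurable_EFinP; apply: measurable_funM => //.
  exact: measurableT_comp.
have max0 (h : T -> R) x : 0 <= (Order.max (h x - t) 0 : R)%:E by rewrite lee_fin le_max lexx orbT.
have t0' (h : T -> R) x : 0 <= (t * phi (h x))%:E by rewrite lee_fin mulr_ge0.
pose a := \int[mu]_x (t * phi (f x))%:E.
have ka : \int[mu]_x (t * phi (k x))%:E = a.
  apply: (kf (psi := fun x => (t * phi x)%:E)).
    by apply/measurable_EFinP; exact: measurable_funM.
  by move=> x; rewrite lee_fin mulr_ge0.
have afin : a \is a fin_num.
  rewrite ge0_fin_numE; last by apply: integral_ge0 => x _; exact: t0'.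
  apply: (@le_lt_trans _ _ 1); last exact: ltry; rewrite -f1; apply: ge0_le_integral => //.
  - exact: mt.
  - exact/measurable_EFinP.
  - move=> x _; rewrite lee_fin /phi; case: ltP => tf; rewrite ?mulr1 ?mulr0//.
    exact: ltW.
rewrite -(@leeD2rE _ a)//.
have -> : \int[mu]_x (Order.max (f x - t) 0)%:E + a = \int[mu]_x ((phi (f x))%:E * (f x)%:E).
  rewrite -ge0_integralD//; [|exact: mmax|exact: mt].
  apply: eq_integral => x _; rewrite -EFinM -EFinD /phi; congr EFin.
  by case: (ltP t (f x)) => tf /=; [rewrite max_l|rewrite max_r]; lra.
apply: le_trans (@fg_nondecreasing (EFin \o phi) mphiE _ _) _.
- by move=> x; rewrite lee_fin.
- move=> x y _ xy; rewrite lee_fin /phi ler_nat.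
  by case: (ltP t x) => // tx; rewrite (lt_le_trans tx xy).
rewrite -ka -ge0_integralD//; [|exact: mmax|exact: mt].
apply: ge0_le_integral => //.
- by move=> x _; rewrite mule_ge0 ?lee_fin.
- apply: emeasurable_funM; last exact/measurable_EFinP.
  exact: (measurableT_comp mphiE mk).
- by apply: emeasurable_funD; [exact: mmax|exact: mt].
- move=> x _; rewrite -EFinM -EFinD lee_fin /phi.
  have : (g x - t <= Order.max (g x - t) 0 /\ 0 <= Order.max (g x - t) 0)%R.
    by rewrite !le_max !lexx orbT.
  by case: (t < k x)%R => -[? ?] /=; lra.
Qed.

(** Let [I] be the integral of [f^al], which is also that of [k^al]. The comparison and the tangent
    at [k] give [al I <= int g^al + (al - 1) I]; the bound [M] makes [I] finite, so that it can be
    subtracted. *)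
Lemma integral_powR_ge (al M : R) : (1 < al)%R -> (forall x, (f x <= M)%R) ->
  \int[mu]_x (f x `^ al)%:E <= \int[mu]_x (g x `^ al)%:E.
Proof.
move=> al1 fM; have al0 : (0 < al)%R by lra.
have alB : (0 < al - 1)%R by lra.
have cancel (a c : R) : (al * c <= a + (al - 1) * c -> c <= a)%R by move=> h; lra.
have mpow (h : T -> R) p : measurable_fun setT h ->
    measurable_fun setT (fun x : T => (h x `^ p)%:E : \bar R).
  move=> mh; apply/measurable_EFinP.
  exact: (measurableT_comp (measurable_powR p)).
have [I IE] : exists I, I = \int[mu]_x (f x `^ al)%:E by eexists.
have If : \int[mu]_x ((f x `^ (al - 1))%:E * (f x)%:E) = I.
  by rewrite IE; apply: eq_integral => x _; rewrite -EFinM mulrC mulr_powRB1.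
have kI : \int[mu]_x (k x `^ al)%:E = I.
  rewrite IE; apply: (kf (psi := fun x => (x `^ al)%:E)) => [|x]; last by rewrite lee_fin powR_ge0.
  by apply/measurable_EFinP; exact: measurable_powR.
have le_tangent : al%:E * I <= \int[mu]_x (g x `^ al)%:E + (al - 1)%:E * I.
  rewrite -{2}kI -ge0_integralZl//; last 3 first.
  - exact: mpow.
  - by move=> x _; rewrite lee_fin powR_ge0.
  - by rewrite lee_fin ltW.
  rewrite -ge0_integralD//; last 4 first.
  - by move=> x _; rewrite lee_fin powR_ge0.
  - exact: mpow.
  - by move=> x _; rewrite mule_ge0 ?lee_fin ?powR_ge0// ltW.
  - by apply: emeasurable_funM => //; exact: mpow.
  apply: (@le_trans _ _ (al%:E * \int[mu]_x ((k x `^ (al - 1))%:E * (g x)%:E))).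
    apply: lee_wpmul2l; first by rewrite lee_fin ltW.
    rewrite -If; apply: (@fg_nondecreasing (fun x => (x `^ (al - 1))%:E)) => [|x|x y x0 xy].
    - by apply/measurable_EFinP; exact: measurable_powR.
    - by rewrite lee_fin powR_ge0.
    - by rewrite lee_fin ge0_ler_powR ?nnegrE//; [lra|exact: le_trans xy].
  rewrite -ge0_integralZl//; last 3 first.
  - by apply: emeasurable_funM; [exact: mpow|exact/measurable_EFinP].
  - by move=> x _; rewrite mule_ge0 ?lee_fin ?powR_ge0//.
  - by rewrite lee_fin ltW.
  apply: ge0_le_integral => //.
  - by move=> x _; rewrite !mule_ge0 ?lee_fin ?powR_ge0// ltW.
  - apply: emeasurable_funM => //.
    by apply: emeasurable_funM; [exact: mpow|exact/measurable_EFinP].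
  - apply: emeasurable_funD; first exact: mpow.
    by apply: emeasurable_funM => //; exact: mpow.
  - move=> x _; rewrite -!EFinM -EFinD lee_fin; exact: powR_tangent_ge.
have Ifin : I \is a fin_num.
  rewrite ge0_fin_numE; last by rewrite IE; apply: integral_ge0 => x _; rewrite lee_fin powR_ge0.
  apply: (@le_lt_trans _ _ ((M `^ (al - 1))%:E * 1)); last by rewrite mule1 ltry.
  rewrite -f1 -ge0_integralZl//; last 3 first.
  - exact/measurable_EFinP.
  - by move=> x _; rewrite lee_fin.
  - by rewrite lee_fin powR_ge0.
  rewrite -If; apply: ge0_le_integral => //.
  - by move=> x _; rewrite mule_ge0 ?lee_fin ?powR_ge0//.
  - by apply: emeasurable_funM; [exact: mpow|exact/measurable_EFinP].
  - by apply: emeasurable_funM => //; exact/measurable_EFinP.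
  - move=> x _; rewrite lee_wpmul2r ?lee_fin// ge0_ler_powR ?nnegrE//; first lra.
    exact: le_trans (fM x).
move: le_tangent; rewrite -IE -(fineK Ifin) -EFinM; move: (fine I) => c.
case: (\int[mu]_x (g x `^ al)%:E) => [r| |].
- by rewrite -EFinM -EFinD !lee_fin => /cancel.
- by move=> _; exact: leey.
- by rewrite addNye leeNy_eq.
Qed.

(** The tangent at [k] bounds [int g^al] by [(1 - al) I + al int k^(al-1) g], and the comparison
    bounds the last integral by [I]. Nothing is subtracted, so [I] may be infinite. *)
Lemma integral_powR_le (al : R) : (0 < al < 1)%R ->
  \int[mu]_x (g x `^ al)%:E <= \int[mu]_x (f x `^ al)%:E.
Proof.
move=> al01; have /andP[al0 al1] := al01; have alB : (0 < 1 - al)%R by lra.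
have mpow (h : T -> R) p : measurable_fun setT h ->
    measurable_fun setT (fun x : T => (h x `^ p)%:E : \bar R).
  move=> mh; apply/measurable_EFinP.
  exact: (measurableT_comp (measurable_powR p)).
have [I IE] : exists I, I = \int[mu]_x (f x `^ al)%:E by eexists.
(* The library value of 0 to the power [al - 1] is 0, which would break monotonicity. The value
   [+oo] restores it and settles the tangent inequality where [k] vanishes. *)
pose phi (x : R) := if (x <= 0)%R then +oo else (x `^ (al - 1))%:E.
have phi0 x : 0 <= phi x by rewrite /phi; case: ifPn => // _; rewrite lee_fin powR_ge0.
have mphi : measurable_fun setT phi.
  apply: measurable_fun_ifT => //; first exact: measurable_fun_ler.
  by apply/measurable_EFinP; exact: measurable_powR.
have kI : \int[mu]_x (k x `^ al)%:E = I.
  rewrite IE; apply: (kf (psi := fun x => (x `^ al)%:E)) => [|x]; last by rewrite lee_fin powR_ge0.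
  by apply/measurable_EFinP; exact: measurable_powR.
have If : \int[mu]_x (phi (f x) * (f x)%:E) = I.
  rewrite IE; apply: eq_integral => x _; rewrite /phi; case: ifPn => [fx|fx].
    have -> : f x = 0%R by have := f0 x; lra.
    by rewrite mule0 powR0// gt_eqF.
  by rewrite -EFinM mulrC mulr_powRB1.
rewrite -IE (_ : I = (1 - al)%:E * I + al%:E * I); last first.
  by rewrite -ge0_muleDl ?lee_fin ?(ltW alB) ?(ltW al0)// -EFinD subrK mul1e.
apply: (@le_trans _ _ ((1 - al)%:E * I + al%:E * \int[mu]_x (phi (k x) * (g x)%:E))); last first.
  apply: leeD2l; apply: lee_wpmul2l; first by rewrite lee_fin ltW.
  rewrite -If; apply: fg_nonincreasing => // x y x0 xy; rewrite /phi.
  case: ifPn => y0; first by rewrite ifT//; exact: le_trans y0.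
  case: ifPn => [_|x0']; first by rewrite leey.
  rewrite lee_fin -ltNge in x0' *; rewrite -opprB !powRN lef_pV2 ?posrE ?powR_gt0//; last first.
    exact: lt_le_trans xy.
  by rewrite ge0_ler_powR ?nnegrE//; [lra|exact: le_trans xy].
rewrite -kI -!ge0_integralZl//; last 6 first.
- by apply: emeasurable_funM; [exact: (measurableT_comp mphi)|exact/measurable_EFinP].
- by move=> x _; rewrite mule_ge0 ?lee_fin//.
- by rewrite lee_fin ltW.
- exact: mpow.
- by move=> x _; rewrite lee_fin powR_ge0.
- by rewrite lee_fin ltW.
rewrite -ge0_integralD//; last 4 first.
- by move=> x _; rewrite mule_ge0 ?lee_fin ?powR_ge0// ltW.
- by apply: emeasurable_funM => //; exact: mpow.
- by move=> x _; rewrite !mule_ge0 ?lee_fin// ltW.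
- apply: emeasurable_funM => //.
  by apply: emeasurable_funM; [exact: (measurableT_comp mphi)|exact/measurable_EFinP].
apply: ge0_le_integral => //.
- by move=> x _; rewrite lee_fin powR_ge0.
- exact: mpow.
- apply: emeasurable_funD.
    by apply: emeasurable_funM => //; exact: mpow.
  apply: emeasurable_funM => //.
  by apply: emeasurable_funM; [exact: (measurableT_comp mphi)|exact/measurable_EFinP].
move=> x _; rewrite /phi; case: ifPn => [kx|kx].
  have -> : k x = 0%R by have := k0 x; lra.
  have [->|gx] := eqVneq (g x) 0%R.
    by rewrite powR0 ?gt_eqF// !mule0 adde0.
  have gx0 : (0 < g x)%R by rewrite lt_neqAle eq_sym gx g0.
  rewrite gt0_mulye ?lte_fin//.
  by rewrite gt0_muley ?lte_fin// addey// leey.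
by rewrite -!EFinM -EFinD lee_fin powR_tangent_le// ltNge.
Qed.

(** By [integral_xlnx] it suffices to compare the integrals of [f (ln M - ln f)] and
    [g (ln M - ln g)]. The Gibbs inequality replaces [ln g] by [ln k], and the comparison then
    passes to [f]. *)
Lemma integral_xlnx_le (M : R) : (1 <= M)%R -> (forall x, (f x <= M)%R) ->
  (forall x, (g x <= M)%R) ->
  \int[mu]_x (f x * ln (f x))%:E <= \int[mu]_x (g x * ln (g x))%:E.
Proof.
move=> M1 fM gM; rewrite !(@integral_xlnx _ _ _ mu _ M)//.
apply: leeB => //.
(* The maximum with 0 keeps [phi] nonnegative beyond [M]; [+oo] replaces the library value of [ln]
   at arguments that are not positive. *)
pose phi (x : R) := if (x <= 0)%R then +oo else (Order.max (ln M - ln x) 0)%:E.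
have phi0 x : 0 <= phi x.
  by rewrite /phi; case: ifPn => // _; rewrite lee_fin le_max lexx orbT.
have mphi : measurable_fun setT phi.
  apply: measurable_fun_ifT => //; first exact: measurable_fun_ler.
  apply/measurable_EFinP; apply: measurable_maxr => //.
  by apply: measurable_funB => //; exact: measurable_ln.
have Vf : \int[mu]_x (phi (f x) * (f x)%:E) = \int[mu]_x (f x * (ln M - ln (f x)))%:E.
  apply: eq_integral => x _; rewrite /phi; case: ifPn => [fx|fx].
    have -> : f x = 0%R by have := f0 x; lra.
    by rewrite mule0 mul0r.
  rewrite -ltNge in fx; rewrite -EFinM mulrC max_l// subr_ge0 ler_ln ?posrE//.
  exact: lt_le_trans (fM x).
rewrite -Vf; apply: (@le_trans _ _ (\int[mu]_x (phi (k x) * (g x)%:E))); last first.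
  apply: fg_nonincreasing => // x y x0 xy; rewrite /phi.
  case: ifPn => y0; first by rewrite ifT//; exact: le_trans y0.
  case: ifPn => [_|x0']; first by rewrite leey.
  rewrite lee_fin -ltNge in x0' *; rewrite ge_max !le_max lexx !orbT andbT.
  have lnxy : (ln x <= ln y)%R by rewrite ler_ln ?posrE//; exact: lt_le_trans xy.
  by apply/orP; left; lra.
have k1 : \int[mu]_x (k x)%:E = 1.
  rewrite -f1; have := kf (psi := fun x => (Order.max x 0)%:E).
  under eq_integral do rewrite max_l//.
  under [in X in _ -> _ -> _ = X]eq_integral do rewrite max_l//.
  apply; last by move=> x; rewrite lee_fin le_max lexx orbT.
  by apply/measurable_EFinP; exact: measurable_maxr.
have mgap := measurable_xlnx_gap M mg; have gap0 := xlnx_gap_ge0 g0 M1 gM.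
have mpg : measurable_fun setT (fun x => phi (k x) * (g x)%:E).
  by apply: emeasurable_funM; [exact: (measurableT_comp mphi)|exact/measurable_EFinP].
(* The unit added on the left is the mass of [g], the one on the right the mass of [k]; the
   inequality becomes the pointwise [ln_tangent]. *)
rewrite -(@leeD2rE _ 1)// -{1}g1 -k1 -!ge0_integralD//; first last.
- exact/measurable_EFinP.
- by move=> x _; rewrite lee_fin.
- by move=> x _; rewrite lee_fin.
- exact/measurable_EFinP.
- by move=> x _; rewrite lee_fin.
- by move=> x _; rewrite mule_ge0 ?lee_fin.
apply: ge0_le_integral => //.
- by move=> x _; rewrite adde_ge0 ?lee_fin.
- by apply: emeasurable_funD => //; exact/measurable_EFinP.
- by apply: emeasurable_funD => //; exact/measurable_EFinP.
move=> x _; have [gx|gx] := eqVneq (g x) 0%R.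
  by rewrite gx mul0r mule0 !add0e lee_fin.
have gx0 : (0 < g x)%R by rewrite lt_neqAle eq_sym gx g0.
rewrite /phi; case: ifPn => [kx|]; first by rewrite gt0_mulye ?lte_fin// addye ?leey.
rewrite -ltNge => kx; rewrite -EFinM -!EFinD lee_fin.
have := ln_tangent gx0 kx.
have : ((ln M - ln (k x)) * g x <= Order.max (ln M - ln (k x)) 0 * g x)%R.
  by rewrite ler_pM2r// le_max lexx.
by lra.
Qed.

End density_comparison.

(** * Rearrangements and majorization *)

Section ball_volume.
Context {R : realType} {d : nat}.
Local Open Scope ereal_scope.
Implicit Types (x : d.-tuple R) (r : R).

Lemma enorm_ge0 x : (0 <= enorm x)%R. Proof. exact: sqrtr_ge0. Qed.

Lemma measurable_enorm : measurable_fun setT (@enorm R d).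
Proof.
have msum : measurable_fun setT (fun x : d.-tuple R => \sum_(i < d) tnth x i ^+ 2)%R.
  apply/measurable_EFinP.
  rewrite (_ : _ \o _ = fun x : d.-tuple R => \sum_(i < d) (tnth x i ^+ 2)%:E).
    apply: emeasurable_sum => i; apply/measurable_EFinP/measurable_funX.
    exact: measurable_tnth.
  by apply/funext => x /=; rewrite sumEFin.
apply: (measurableT_comp _ msum); apply: continuous_measurable_fun.
exact: sqrt_continuous.
Qed.

Lemma measurable_eball r : measurable (eball r : set (d.-tuple R)).
Proof.
rewrite -[X in measurable X]setTI.
exact: (measurable_fun_ltr measurable_enorm (measurable_cst r) measurableT
   (Y := [set true])).
Qed.

Lemma enorm_scale r x : (0 <= r)%R ->
  enorm (vaff [tuple r | _ < d] [tuple 0%R | _ < d] x) = (r * enorm x)%R.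
Proof.
move=> r0; rewrite -{2}(ger0_norm r0) -sqrtr_sqr -sqrtrM ?sqr_ge0//.
congr Num.sqrt; rewrite mulr_sumr; apply: eq_bigr => i _.
by rewrite !tnth_mktuple addr0 exprMn.
Qed.

Lemma eball_le0 r : (r <= 0)%R -> eball r = set0 :> set (d.-tuple R).
Proof.
move=> r0; apply/seteqP; split => // x /= xr.
by have := enorm_ge0 x; rewrite leNgt (lt_le_trans xr r0).
Qed.

Lemma lebesgue_tuple_eball r : (0 < r)%R ->
  lebesgue_tuple d (eball r) = (r ^+ d)%:E * lebesgue_tuple d (eball 1).
Proof.
move=> r0; have mB (s : R) := measurable_eball s.
have mI (s : R) : measurable_fun setT (EFin \o \1_(eball s : set (d.-tuple R)) : _ -> \bar R).
  by apply/measurable_EFinP; exact: measurable_indic.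
have VE (s : R) : lebesgue_tuple d (eball s) = \int[lebesgue_tuple d]_x (\1_(eball s) x)%:E.
  by rewrite integral_indic; [rewrite setIT|exact: measurableT|exact: mB].
have c0 (i : 'I_d) : tnth [tuple r | _ < d] i != 0%R by rewrite tnth_mktuple gt_eqF.
rewrite !VE -(@ge0_integral_vaff _ _ [tuple r | _ < d] [tuple 0%R | _ < d]
  (EFin \o \1_(eball r)) c0 (mI r)); last by move=> x; rewrite lee_fin.
under eq_bigr do rewrite tnth_mktuple gtr0_norm//.
rewrite prodr_const card_ord; congr (_ * _); apply: eq_integral => x _.
rewrite !indicE; congr (nat_of_bool _)%:R%:E; apply/idP/idP;
  rewrite !inE /eball/= enorm_scale ?ltW//.
  by rewrite gtr_pMr.
by rewrite gtr_pMr.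
Qed.

Lemma lebesgue_tuple_eball1_gt0 : 0 < lebesgue_tuple d (eball 1 : set (d.-tuple R)).
Proof.
(* With [e = 1/(d + 1)], points of the cube of half-side [e] have squared norm at most [d e < 1],
   also when [d = 0]. *)
pose e : R := (d.+1%:R^-1)%R; have e0 : (0 < e)%R by rewrite invr_gt0.
have e1 : (e <= 1)%R by rewrite invf_le1// ler1n.
have mI : measurable (`](- e)%R, e[%classic : set R) by exact: measurable_itv.
have := @lebesgue_tuple_box R d (fun=> `](- e)%R, e[%classic) (fun=> mI).
rewrite lebesgue_measure_itv/= lte_fin ifT; last by lra.
move=> h; apply: (@lt_le_trans _ _ (lebesgue_tuple d
  [set x | forall i : 'I_d, `](- e)%R, e[%classic (tnth x i)])).
  by rewrite h -EFinB prodEFin lte_fin prodr_gt0// => i _; lra.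
apply: le_measure; rewrite ?inE.
- rewrite (_ : mkset _ = \bigcap_(i in [set: 'I_d])
    ((fun x : d.-tuple R => tnth x i) @^-1` `](- e)%R, e[%classic)).
    apply: fin_bigcap_measurable => // i _.
    by rewrite -[X in measurable X]setTI; exact: measurable_tnth.
  by apply/seteqP; split => [x h' i _|x h' i]; [exact: h'|exact: (h' i)].
- exact: measurable_eball.
move=> x /= xe; rewrite /eball /= /enorm -[ltRHS]sqrtr1 ltr_sqrt//.
apply: (@le_lt_trans _ _ (\sum_(i < d) e)%R).
  apply: ler_sum => i _; have := xe i; rewrite in_itv/= => /andP[? ?]; nra.
rewrite sumr_const card_ord -mulr_natl ltr_pdivrMr// mul1r ltr_nat//.
Qed.

Lemma lebesgue_tuple_eball1_fin : lebesgue_tuple d (eball 1 : set (d.-tuple R)) < +oo.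
Proof.
have mI : measurable (`[(- 1)%R, 1%R]%classic : set R) by exact: measurable_itv.
have := @lebesgue_tuple_box R d (fun=> `[(- 1)%R, 1%R]%classic) (fun=> mI).
rewrite lebesgue_measure_itv/= lte_fin ifT; last by lra.
move=> h; apply: (@le_lt_trans _ _ (lebesgue_tuple d
  [set x | forall i : 'I_d, `[(- 1)%R, 1%R]%classic (tnth x i)])); last first.
  by rewrite h -EFinB prodEFin ltry.
apply: le_measure; rewrite ?inE.
- exact: measurable_eball.
- rewrite (_ : mkset _ = \bigcap_(i in [set: 'I_d])
    ((fun x : d.-tuple R => tnth x i) @^-1` `[(- 1)%R, 1%R]%classic)).
    apply: fin_bigcap_measurable => // i _.
    by rewrite -[X in measurable X]setTI; exact: measurable_tnth.
  by apply/seteqP; split => [x h' i _|x h' i]; [exact: h'|exact: (h' i)].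
move=> x /= x1 i; rewrite in_itv/= -ler_norml -sqrtr_sqr -[leRHS]sqrtr1.
rewrite ler_sqrt//; apply: (@le_trans _ _ (\sum_(i < d) tnth x i ^+ 2)%R).
  by rewrite (bigD1 i)//= lerDl sumr_ge0// => j _; exact: sqr_ge0.
by have := ltW x1; rewrite /enorm -[leRHS]sqrtr1 ler_sqrt.
Qed.

End ball_volume.

(** In positive dimension the radius solves [r^d v = a], with [v] the volume of the unit ball and
    [a] that of [A]. In dimension 0 the space is one point of mass 1, and the radius is 0 or 1. The
    last clause describes the rearranged set without naming its radius. *)
Lemma ball_of_volume {R : realType} (d : nat) (A : set (d.-tuple R)) :
  measurable A -> (lebesgue_tuple d A < +oo)%E ->
  exists r : R, [/\ 0 <= r, lebesgue_tuple d (eball r) = lebesgue_tuple d A &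
    forall x : d.-tuple R, (lebesgue_tuple d (eball (enorm x)) < lebesgue_tuple d A)%E =
      (enorm x < r)].
Proof.
case: d A => [|n] A mA Afin.
  have enorm0 (x : 0.-tuple R) : enorm x = 0 by rewrite /enorm big_ord0 sqrtr0.
  have [xA|xA] := pselect (A [tuple of [::]]).
    exists 1; rewrite /= !diracE (mem_set xA); split => //.
      by rewrite mem_set// /eball/= enorm0.
    by move=> x; rewrite enorm0 eball_le0// measure0 lte_fin !ltr01.
  exists 0; rewrite /= !diracE (memNset xA); split => //.
    by rewrite memNset// /eball/= enorm0 ltxx.
  by move=> x; rewrite enorm0 eball_le0// measure0 ltxx ltxx.
have V0 := @lebesgue_tuple_eball1_gt0 R n.+1.
have Voo := @lebesgue_tuple_eball1_fin R n.+1.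
have Vfin : lebesgue_tuple n.+1 (eball 1 : set (n.+1.-tuple R)) \is a fin_num.
  by rewrite ge0_fin_numE// ltW.
have Af : lebesgue_tuple n.+1 A \is a fin_num by rewrite ge0_fin_numE// measure_ge0.
pose v := fine (lebesgue_tuple n.+1 (eball 1 : set (n.+1.-tuple R))).
pose a := fine (lebesgue_tuple n.+1 A).
have v0 : 0 < v by rewrite fine_gt0// V0 Voo.
have a0 : 0 <= a by rewrite fine_ge0// measure_ge0.
have VE (s : R) : 0 <= s ->
    lebesgue_tuple n.+1 (eball s : set (n.+1.-tuple R)) = (s ^+ n.+1 * v)%:E.
  rewrite le_eqVlt => /predU1P[<-|s0].
    by rewrite eball_le0// measure0 expr0n mul0r.
  by rewrite lebesgue_tuple_eball// -(fineK Vfin) -EFinM.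
pose r := (a / v) `^ (n.+1%:R^-1).
have rE : r ^+ n.+1 * v = a.
  rewrite -powR_mulrn ?powR_ge0// /r -powRrM mulVf// powRr1 ?divr_ge0// ?ltW//.
  by rewrite divfK// gt_eqF.
exists r; split; first exact: powR_ge0.
  by rewrite VE ?powR_ge0// rE fineK.
move=> x; rewrite VE ?enorm_ge0// -(fineK Af) -/a -rE lte_fin ltr_pM2r//.
by rewrite ltr_pXn2r// ?nnegrE ?enorm_ge0 ?powR_ge0.
Qed.

(** * Layer-cake formula *)

Section layer_cake.
Context dT (T : measurableType dT) (R : realType).
Variable mu : {sigma_finite_measure set T -> \bar R}.
Local Open Scope ereal_scope.

(** Tonelli's theorem for the indicator of the region [0 < s < h x] under the graph. *)
Lemma layer_cake (h : T -> \bar R) : measurable_fun setT h -> (forall x, 0 <= h x) ->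
  \int[mu]_x h x = \int[lebesgue_measure]_s
    (if (0 < s)%R then mu [set x | s%:E < h x] else 0).
Proof.
move=> mh h0.
pose E : set (T * measurableTypeR R) := [set p | (0 < p.2)%R /\ p.2%:E < h p.1].
have mE : measurable E.
  rewrite (_ : E = [set p : T * measurableTypeR R | 0 < p.2%:E] `&`
      [set p : T * measurableTypeR R | p.2%:E < h p.1]); last first.
    by apply/seteqP; split => -[x s] [] /=; rewrite lte_fin.
  have m2 : measurable_fun setT (fun p : T * measurableTypeR R => p.2%:E : \bar R).
    by apply/measurable_EFinP; exact: measurable_snd.
  have m1 : measurable_fun setT (fun p : T * measurableTypeR R => h p.1).
    exact: (measurableT_comp mh).
  apply: measurableI.
    by rewrite -[X in measurable X]setTI; apply: measurable_lte.
  by rewrite -[X in measurable X]setTI; apply: measurable_lte.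
have mI : measurable_fun setT (fun p => (\1_E p)%:E : \bar R).
  by apply/measurable_EFinP; exact: measurable_indic.
have inner x : \int[lebesgue_measure]_s (\1_E (x, s))%:E = h x.
  rewrite (_ : (fun s => _) = fun s => (\1_(xsection E x) s)%:E); last first.
    apply/funext => s; rewrite !indicE; congr (_ %:R%:E).
    by rewrite mem_xsection.
  rewrite integral_indic//; last exact: measurable_xsection.
  rewrite setIT; have -> : xsection E x = [set s | (0 < s)%R /\ s%:E < h x].
    by apply/seteqP; split => s; rewrite /xsection/= inE.
  case: (h x) (h0 x) => [r| |]//= r0.
    rewrite (_ : mkset _ = `]0%R, r[%classic); last first.
      by apply/seteqP; split => s/=; rewrite in_itv/= lte_fin => /andP.
    rewrite lebesgue_measure_itv/= lte_fin; case: ifPn => [_|].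
      by rewrite sube0.
    by rewrite -leNgt => r0'; congr EFin; apply/le_anti; rewrite r0' -lee_fin r0.
  rewrite (_ : mkset _ = `]0%R, +oo[%classic); last first.
    by apply/seteqP; split => s/=; rewrite in_itv/= andbT ltry => // -[].
  by rewrite lebesgue_measure_itv/= ltry.
have E0 p : 0 <= (\1_E p)%:E :> \bar R by rewrite lee_fin.
have := @fubini_tonelli _ _ T (measurableTypeR R) R mu lebesgue_measure
  (fun p => (\1_E p)%:E) mI E0.
under eq_integral do rewrite inner.
move=> ->; apply: eq_integral => s _; case: ifPn => s0; last first.
  by apply: integral0_eq => x _; rewrite indicE memNset//= => -[s1]; rewrite s1 in s0.
have mhs : measurable [set x | s%:E < h x].
  by rewrite -[X in measurable X]setTI; apply: measurable_lte => //; exact: measurable_cst.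
rewrite -[X in mu X](setIT [set x | s%:E < h x]) -integral_indic//.
apply: eq_integral => x _; rewrite !indicE; congr (nat_of_bool _)%:R%:E.
by apply/idP/idP; rewrite !inE /E/=; [case|split].
Qed.

Lemma integral_superlevel_eq (h1 h2 : T -> \bar R) :
  measurable_fun setT h1 -> (forall x, 0 <= h1 x) ->
  measurable_fun setT h2 -> (forall x, 0 <= h2 x) ->
  (forall s : R, (0 < s)%R -> mu [set x | s%:E < h1 x] = mu [set x | s%:E < h2 x]) ->
  \int[mu]_x h1 x = \int[mu]_x h2 x.
Proof.
move=> mh1 h10 mh2 h20 h12; rewrite !layer_cake//; apply: eq_integral => s _.
by case: ifPn => // s0; exact: h12.
Qed.

End layer_cake.

(** * Symmetric decreasing rearrangements and their excess integrals *)

Section rearrangement.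
Context {R : realType} {d : nat}.
Local Open Scope ereal_scope.
Local Notation mu := (lebesgue_tuple d).
Implicit Types (f g : d.-tuple R -> R) (fs gs : d.-tuple R -> \bar R).

Lemma measurable_superlevel f (t : R) : measurable_fun setT f ->
  measurable [set x | (t < f x)%R].
Proof.
move=> mf; rewrite -[X in measurable X]setTI.
exact: (measurable_fun_ltr (measurable_cst t) mf measurableT (Y := [set true])).
Qed.

Lemma superlevel_finite f (t : R) : measurable_fun setT f -> (forall x, 0 <= f x)%R ->
  \int[mu]_x (f x)%:E < +oo -> (0 < t)%R -> mu [set x | (t < f x)%R] < +oo.
Proof.
move=> mf f0 foo t0; have mE := measurable_superlevel t mf.
suff : t%:E * mu [set x | (t < f x)%R] <= \int[mu]_x (f x)%:E.
  move=> /le_lt_trans/(_ foo); rewrite !ltey; apply: contra => /eqP ->.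
  by rewrite gt0_muley// lte_fin.
rewrite -[X in mu X]setIT -integral_indic// -ge0_integralZl//; last 2 first.
- by apply/measurable_EFinP; exact: measurable_indic.
- by rewrite lee_fin ltW.
apply: ge0_le_integral => //.
- by move=> x _; rewrite mule_ge0 ?lee_fin// ltW.
- apply: emeasurable_funM => //.
  by apply/measurable_EFinP; exact: measurable_indic.
- exact/measurable_EFinP.
- move=> x _; rewrite indicE -EFinM lee_fin.
  by case: (boolP (x \in _)) => /=; rewrite ?mulr0// mulr1 inE/= => /ltW.
Qed.

Lemma rearrangement_exists f : measurable_fun setT f -> (forall x, 0 <= f x)%R ->
  \int[mu]_x (f x)%:E < +oo -> exists fs, fun_rearrangement f fs.
Proof.
move=> mf f0 foo.
pose A (x : d.-tuple R) := [set s%:E | s in [set s : R | (0 < s)%R /\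
  mu (eball (enorm x)) < mu [set y | (s < f y)%R]]].
(* The rearrangement at [x] is the supremum of the levels whose superlevel set is larger than the
   ball of radius [|x|]; 0 is added because the supremum of the empty set is [-oo]. *)
pose fs x := ereal_sup (A x `|` [set 0]).
exists fs; split=> [x|t t0]; first by apply: ereal_sup_ubound; right.
have mE (s : R) := measurable_superlevel s mf.
have superE : [set x | t%:E < fs x] =
    [set x | mu (eball (enorm x)) < mu [set y | (t < f y)%R]].
  apply/seteqP; split => x /=.
    move=> /ereal_sup_gt[y [[s [s0 xs] <-]|->]]; rewrite lte_fin => ts.
      apply: (lt_le_trans xs); apply: le_measure; rewrite ?inE// => y'/=.
      exact: lt_trans.
    by have := lt_trans t0 ts; rewrite ltxx.
  move=> xt.
  (* Continuity from below of the measure yields a level strictly above [t] that still qualifies, as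
     the strict inequality [t < fs x] demands. *)
  pose E n := [set y | (t + n.+1%:R^-1 < f y)%R].
  have EU : [set y | (t < f y)%R] = \bigcup_n E n.
    apply/seteqP; split => y /=; last first.
      by move=> [n _]; apply: lt_trans; rewrite ltrDl invr_gt0.
    move=> ty; have [n _ ny] : exists2 n, True & (n.+1%:R^-1 < f y - t)%R.
      have := @near_infty_natSinv_lt R (PosNum (ltac:(by rewrite subr_gt0) : 0 < f y - t)%R).
      by move=> [N _ /(_ N (leqnn N))] h; exists N.
    by exists n => //=; rewrite /E/= -ltrBrDl.
  have cvgE : mu \o E @ \oo --> mu (\bigcup_n E n).
    apply: nondecreasing_cvg_mu => //.
    - by move=> n; exact: mE.
    - by rewrite -EU.
    - move=> n m nm; apply/subsetPset => y /=; apply: le_lt_trans.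
      by rewrite lerD2l lef_pV2 ?posrE// ler_nat ltnS.
  rewrite EU in xt.
  have [n xn] : exists n, mu (eball (enorm x)) < mu (E n).
    apply: contrapT => /forallNP h; move: xt; apply/negP; rewrite -leNgt.
    rewrite -(cvg_lim _ cvgE)//; apply: lime_le; first by apply/cvg_ex; eexists; exact: cvgE.
    by apply: nearW => n; rewrite leNgt; exact/negP/h.
  apply: (@lt_le_trans _ _ (t + n.+1%:R^-1)%:E); first by rewrite lte_fin ltrDl invr_gt0.
  apply: ereal_sup_ubound; left; exists (t + n.+1%:R^-1)%R => //; split => //.
  by rewrite addr_gt0// invr_gt0.
have [r [r0 rE rP]] := ball_of_volume (mE t) (superlevel_finite mf f0 foo t0).
exists r; rewrite superE (_ : mkset _ = eball r)//.
by apply/seteqP; split => x /=; rewrite rP.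
Qed.

Section rearrangement_theory.
Variables (f : d.-tuple R -> R) (fs : d.-tuple R -> \bar R).
Hypothesis ffs : fun_rearrangement f fs.

Lemma measurable_rearrangement : measurable_fun setT fs.
Proof.
have [fs0 fsE] := ffs.
have mpos (t : R) : (0 < t)%R -> measurable [set x | t%:E < fs x].
  by move=> /fsE[r [_ -> _]]; exact: measurable_eball.
apply: (measurability _ (ErealGenOInfty.measurableE R)) => //.
move=> /= _ [_ [t ->] <-]; rewrite setTI preimage_itvoy.
have [t0|] := ltP 0%R t; first exact: mpos.
rewrite le_eqVlt => /predU1P[->|t0]; last first.
  rewrite (_ : mkset _ = setT)//; apply/seteqP; split => // x _ /=.
  by rewrite (lt_le_trans _ (fs0 x))// lte_fin.
rewrite (_ : mkset _ = \bigcup_n [set x | (n.+1%:R^-1)%:E < fs x]).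
  by apply: bigcupT_measurable => n; apply: mpos; rewrite invr_gt0.
apply/seteqP; split => x /=; last first.
  by move=> [n _]; apply: lt_trans; rewrite lte_fin invr_gt0.
case fx: (fs x) (fs0 x) => [r| |] // _ r0; last by exists 0%N => //=; rewrite fx ltry.
rewrite lte_fin in r0; have := @near_infty_natSinv_lt R (PosNum r0).
by move=> [N _ /(_ N (leqnn N))] h; exists N => //=; rewrite fx lte_fin.
Qed.

(** Otherwise the superlevel set at a level strictly between the two values would be a centered ball
    containing [y] but not [x]. *)
Lemma rearrangement_radial x y : (enorm x <= enorm y)%R -> fs y <= fs x.
Proof.
have [fs0 fsE] := ffs; move=> xy; rewrite leNgt; apply/negP => yx.
have [t /andP[xt ty]] : exists t : R, (fs x < t%:E) && (t%:E < fs y).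
  move: yx (fs0 x); case: (fs x) => [a| |]//; case: (fs y) => [b| |]//.
  - by rewrite lte_fin => ab _; exists ((a + b) / 2)%R; rewrite !lte_fin; lra.
  - by move=> _ _; exists (a + 1)%R; rewrite ltry lte_fin; lra.
have t0 : (0 < t)%R by rewrite -lte_fin (le_lt_trans (fs0 x)).
have [r [_ tE _]] := fsE t t0.
have : [set x | t%:E < fs x] y by [].
rewrite tE => /(le_lt_trans xy) xr.
have : eball r x by [].
by rewrite -tE/= ltNge (ltW xt).
Qed.

(** In the layer-cake formula, level [s] of the excess is level [t + s] of the function, where [f]
    and [fs] have superlevel sets of equal volume. *)
Lemma integral_rearrangement_excess (t : R) : measurable_fun setT f ->
  (forall x, 0 <= f x)%R -> (0 <= t)%R ->
  \int[mu]_x maxe (fs x - t%:E) 0 = \int[mu]_x (Order.max (f x - t) 0)%:E.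
Proof.
move=> mf f0 t0; have [fs0 fsE] := ffs; have mfs := measurable_rearrangement.
apply: integral_superlevel_eq.
- by apply: measurable_maxe => //; exact: emeasurable_funB.
- by move=> x; rewrite le_max lexx orbT.
- apply/measurable_EFinP; apply: measurable_maxr => //.
  exact: measurable_funB.
- by move=> x; rewrite lee_fin le_max lexx orbT.
move=> s s0; have s_le0 : (s < 0)%R = false by rewrite ltNge ltW.
rewrite (_ : mkset _ = [set x | (t + s)%:E < fs x]); last first.
  by apply/seteqP; split => x; rewrite /mkset lt_max lte_fin s_le0 orbF EFinD lteBrDl.
rewrite (_ : [set x | s%:E < _] = [set x | (t + s < f x)%R]); last first.
  by apply/seteqP; split => x; rewrite /mkset lte_fin lt_max s_le0 orbF ltrBrDl.
by have [r [_ _ ->]] := fsE (t + s)%R (ltr_wpDl t0 s0).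
Qed.

End rearrangement_theory.

(** At a level [s] adapted to the ball [B], the integral of [gs] over [B] equals the total excess of
    [gs] over [s] plus [s |B|]. For [fs] the same expression is an upper bound, so comparing the
    excesses at level [s] suffices. *)
Lemma majorized_of_excess f g :
  measurable_fun setT f -> (forall x, 0 <= f x)%R ->
  measurable_fun setT g -> (forall x, 0 <= g x)%R ->
  \int[mu]_x (f x)%:E < +oo -> \int[mu]_x (g x)%:E < +oo ->
  (forall t : R, (0 <= t)%R -> \int[mu]_x (Order.max (f x - t) 0)%:E <=
    \int[mu]_x (Order.max (g x - t) 0)%:E) ->
  majorized f g.
Proof.
move=> mf f0 mg g0 foo goo fg.
have [fs ffs] := rearrangement_exists mf f0 foo.
have [gs ggs] := rearrangement_exists mg g0 goo.
exists fs, gs; split => // r r0.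
have mfs := measurable_rearrangement ffs; have mgs := measurable_rearrangement ggs.
have [fs0 _] := ffs; have [gs0 _] := ggs.
have mB : measurable (eball r : set (d.-tuple R)) by exact: measurable_eball.
have V0 : 0 < mu (eball r).
  by rewrite lebesgue_tuple_eball// mule_gt0 ?lebesgue_tuple_eball1_gt0// lte_fin exprn_gt0.
(* At this level {g^* > t} is contained in the ball, which is contained in
   {g^* >= t}. *)
pose t := ereal_sup ([set gs y | y in [set y | (r <= enorm y)%R]] `|` [set 0]).
have t0 : 0 <= t by apply: ereal_sup_ubound; right.
have gs_out x : ~ eball r x -> gs x <= t.
  by move=> /negP; rewrite -leNgt => rx; apply: ereal_sup_ubound; left; exists x.
have gs_in x : eball r x -> t <= gs x.
  move=> xr; apply: ge_ereal_sup => _ [[y /= ry <-]|->]; last exact: gs0.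
  by apply: rearrangement_radial ggs _ _ _; rewrite ltW// (lt_le_trans xr).
have gsoo : \int[mu]_x gs x < +oo.
  have := integral_rearrangement_excess ggs mg g0 (lexx 0%R).
  under eq_integral do rewrite sube0 max_l//.
  by move=> ->; under eq_integral do rewrite subr0 max_l//.
(* An infinite level would make [gs] infinite on a ball of positive volume, against its
   integrability. *)
have toos : t < +oo.
  rewrite ltey; apply/eqP => tE; move: gsoo; apply/negP; rewrite -leNgt.
  apply: (@le_trans _ _ (\int[mu]_(x in eball r) gs x)); last first.
    exact: ge0_subset_integral.
  rewrite (eq_integral (cst +oo)); last first.
    by move=> x; rewrite inE => /gs_in; rewrite tE leye_eq => /eqP.
  by rewrite integral_cst// gt0_mulye.
have [s tE] : exists s : R, t = s%:E.
  by exists (fine t); rewrite fineK// ge0_fin_numE.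
have s0 : (0 <= s)%R by rewrite -lee_fin -tE.
have mexc (h : d.-tuple R -> \bar R) (D : set (d.-tuple R)) : measurable_fun setT h ->
    measurable_fun D (fun x => maxe (h x - s%:E) 0).
  move=> mh; apply: measurable_funTS; apply: measurable_maxe => //.
  exact: emeasurable_funB.
have exc0 (h : d.-tuple R -> \bar R) x : 0 <= maxe (h x - s%:E) 0.
  by rewrite le_max lexx orbT.
have cst0 : forall x : d.-tuple R, eball r x -> 0 <= cst s%:E x by move=> x _; rewrite lee_fin.
apply: (@le_trans _ _ (\int[mu]_(x in eball r) (maxe (fs x - s%:E) 0 + cst s%:E x))).
  apply: ge0_le_integral => //.
  - exact: measurable_funTS.
  - by apply: emeasurable_funD; [exact: mexc|exact: measurable_cst].
  move=> x _; case: (fs x) (fs0 x) => [a| |] //= a0.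
  by rewrite -EFinB -EFin_max -EFinD lee_fin -lerBlDr le_max lexx.
rewrite ge0_integralD//; last by exact: mexc.
have -> : \int[mu]_(x in eball r) gs x =
    \int[mu]_x maxe (gs x - s%:E) 0 + \int[mu]_(x in eball r) cst s%:E x.
  transitivity (\int[mu]_(x in eball r) (maxe (gs x - s%:E) 0 + cst s%:E x)).
    apply: eq_integral => x; rewrite inE => /gs_in; rewrite tE.
    case: (gs x) => [a| |] //= sa.
    by rewrite -EFinB -EFin_max -EFinD max_l ?subrK// subr_ge0 -lee_fin.
  rewrite ge0_integralD//; last by exact: mexc.
  congr (_ + _); rewrite integral_mkcond; apply: eq_integral => x _.
  rewrite patchE; case: ifPn => // /negP; rewrite inE => /gs_out; rewrite tE => gx.
  by rewrite max_r// sube_le0.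
apply: leeD2r; apply: (@le_trans _ _ (\int[mu]_x maxe (fs x - s%:E) 0)).
  by apply: ge0_subset_integral => //; exact: mexc.
rewrite (integral_rearrangement_excess ffs mf f0 s0).
by rewrite (integral_rearrangement_excess ggs mg g0 s0); exact: fg.
Qed.

End rearrangement.

(** * The contraction theorem *)

Section density_transfer.
Context {R : realType} {d : nat} {disp : measure_display}
  {Omega : measurableType disp} (P : probability Omega R).
Local Open Scope ereal_scope.

Lemma integral_density1 (X : Omega -> d.-tuple R) (f : d.-tuple R -> R) :
  has_density P X f -> \int[lebesgue_tuple d]_x (f x)%:E = 1.
Proof.
move=> [_ _ _ fE]; rewrite -fE; last exact: measurableT.
by rewrite /pushforward preimage_setT probability_setT.
Qed.

(** Two densities of one vector agree almost everywhere; this transfers results from a convenient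
    density to an arbitrary one. *)
Lemma integral_density_comp (X : Omega -> d.-tuple R) (f g : d.-tuple R -> R)
    (psi : R -> R) : has_density P X f -> has_density P X g ->
  measurable_fun setT psi ->
  \int[lebesgue_tuple d]_x (psi (f x))%:E = \int[lebesgue_tuple d]_x (psi (g x))%:E.
Proof.
move=> df dg mpsi; have [_ mf _ _] := df; have [_ mg _ _] := dg.
apply: ae_eq_integral => //.
- by apply/measurable_EFinP; exact: (measurableT_comp mpsi mf).
- by apply/measurable_EFinP; exact: (measurableT_comp mpsi mg).
by have := density_ae_eq df dg; apply: filterS => x /= /[apply] -[->].
Qed.

Lemma renyi_entropy_density (X : Omega -> d.-tuple R) (f g : d.-tuple R -> R) al :
  has_density P X f -> has_density P X g -> renyi_entropy al f = renyi_entropy al g.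
Proof.
move=> df dg; rewrite /renyi_entropy; case: ifPn => _.
  rewrite (@integral_density_comp X f g (fun y => y * ln y)%R)//.
  by apply: measurable_funM => //; exact: measurable_ln.
by rewrite (@integral_density_comp X f g (fun y => y `^ al)%R).
Qed.

End density_transfer.

(** The prefactor [1/(1 - al)] changes sign at 1, which is why the integrals are compared in
    opposite directions on the two sides. *)
Lemma le_renyi_entropy {R : realType} {d : nat} (al : R) (f g : d.-tuple R -> R) :
  0 < al ->
  (1 < al -> (\int[lebesgue_tuple d]_x (f x `^ al)%:E <=
    \int[lebesgue_tuple d]_x (g x `^ al)%:E)%E) ->
  (al < 1 -> (\int[lebesgue_tuple d]_x (g x `^ al)%:E <=
    \int[lebesgue_tuple d]_x (f x `^ al)%:E)%E) ->
  (\int[lebesgue_tuple d]_x (f x * ln (f x))%:E <=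
    \int[lebesgue_tuple d]_x (g x * ln (g x))%:E)%E ->
  (renyi_entropy al g <= renyi_entropy al f)%E.
Proof.
move=> al0 gt1 lt1 eq1; rewrite /renyi_entropy.
have I0 (h : d.-tuple R -> R) :
    (\int[lebesgue_tuple d]_x (h x `^ al)%:E)%E \in `[0%E, +oo%E].
  by rewrite in_itv/= leey andbT integral_ge0// => x _; rewrite lee_fin powR_ge0.
have [al1|al1] := eqVneq al 1; first by rewrite leeN2.
have [h|h] : al < 1 \/ 1 < al by case: (ltgtP al 1) al1 => //; [left|right].
  apply: lee_wpmul2l; last by rewrite lee_lne ?I0//; exact: lt1.
  by rewrite lee_fin invr_ge0 subr_ge0 ltW.
rewrite -opprB invrN EFinN !mulNe leeN2.
apply: lee_wpmul2l; last by rewrite lee_lne ?I0//; exact: gt1.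
by rewrite lee_fin invr_ge0 subr_ge0 ltW.
Qed.

Lemma bounded_convolution {R : realType} {d : nat} (T : d.-tuple R -> d.-tuple R)
    (f g : d.-tuple R -> R) (M : R) : measurable_fun setT T ->
  measurable_fun setT f -> (forall x, 0 <= f x) ->
  measurable_fun setT g -> (forall x, 0 <= g x) ->
  (\int[lebesgue_tuple d]_x (f x)%:E = 1)%E -> (forall x, g x <= M) ->
  exists2 h : d.-tuple R -> R,
    forall z, (h z)%:E = convolution T f g z & forall z, h z <= M.
Proof.
move=> mT mf f0 mg g0 f1 gM.
have le z : (convolution T f g z <= M%:E)%E by exact: convolution_le.
have hE z : (fine (convolution T f g z))%:E = convolution T f g z.
  by rewrite fineK// ge0_fin_numE ?convolution_ge0// (le_lt_trans (le z))// ltry.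
exists (fun z => fine (convolution T f g z)) => // z.
by rewrite -lee_fin hE.
Qed.

Section contraction_densities.
Context {R : realType} {d : nat} {disp : measure_display}
  {Omega : measurableType disp} (P : probability Omega R).
Variables (X W : Omega -> d.-tuple R) (T : d.-tuple R -> d.-tuple R).
Variables (fX fW f g : d.-tuple R -> R).
Hypotheses (indepXW : independent P X W).
Hypotheses (dX : has_density P X fX) (dW : has_density P W fW).
Hypotheses (sW : solid (EFin \o fW)) (cT : strong_contraction T).
Hypotheses (df : has_density P (fun w => vadd (X w) (W w)) f).
Hypotheses (dg : has_density P (fun w => vadd (T (X w)) (W w)) g).
Hypothesis (sf : solid (EFin \o f)).

Let k z := f (vsub z (T [tuple 0 | _ < d])).

Let mf : measurable_fun setT f. Proof. by case: df. Qed.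
Let f0 x : 0 <= f x. Proof. by case: df. Qed.
Let mk : measurable_fun setT k.
Proof. by apply: (measurableT_comp mf); exact: measurable_vsub2. Qed.

Lemma equidistributed_translate : equidistributed (lebesgue_tuple d) k f.
Proof.
move=> psi mpsi psi0.
apply: (@ge0_integral_vsub _ _ (T [tuple 0 | _ < d]) (psi \o f)) => [|x].
  exact: measurableT_comp.
exact: psi0.
Qed.

(** A nondecreasing function of the solid density [f] is solid, and composing it with the
    translation by [T 0] gives the function of [k]. *)
Lemma contraction_nondecreasing_comparison :
  nondecreasing_comparison (lebesgue_tuple d) f k g.
Proof.
move=> phi mphi phi0 phind.
rewrite -(ge0_integral_density (F := phi \o f) df (measurableT_comp mphi mf) (fun x => phi0 _)).
rewrite -(ge0_integral_density (F := phi \o k) dg (measurableT_comp mphi mk) (fun x => phi0 _)).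
apply: (solid_contraction_le indepXW dX dW sW cT (measurableT_comp mphi mf) (fun x => phi0 _)).
by move=> x y xy; apply: phind; [exact: f0|rewrite -lee_fin; exact: sf].
Qed.

Lemma contraction_nonincreasing_comparison :
  nonincreasing_comparison (lebesgue_tuple d) f k g.
Proof.
move=> phi mphi phi0 phini.
rewrite -(ge0_integral_density (F := phi \o f) df (measurableT_comp mphi mf) (fun x => phi0 _)).
rewrite -(ge0_integral_density (F := phi \o k) dg (measurableT_comp mphi mk) (fun x => phi0 _)).
apply: (antisolid_contraction_le indepXW dX dW sW cT (measurableT_comp mphi mf) (fun x => phi0 _)).
by move=> x y xy; apply: phini; [exact: f0|rewrite -lee_fin; exact: sf].
Qed.

End contraction_densities.

Theorem theorem2p9 (R : realType) (d : nat) (disp : measure_display)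
  (Omega : measurableType disp) (P : probability Omega R)
  (X W : {RV P >-> d.-tuple R}) (T : d.-tuple R -> d.-tuple R)
  (indepXW : independent P X W)
  (uncX : unconditional P X) (uncW : unconditional P W)
  (lcX : log_concave P X) (lcW : log_concave P W)
  (contrT : strong_contraction T) :
  let S := fun w : Omega => vadd (X w) (W w) in
  let ST := fun w : Omega => vadd (T (X w)) (W w) in
  [/\ exists f, has_density P S f,
      exists g, has_density P ST g &
      forall f g : d.-tuple R -> R, has_density P S f -> has_density P ST g ->
        majorized f g /\
        forall alpha : R, 0 < alpha ->
          (renyi_entropy alpha g <= renyi_entropy alpha f)%E].
Proof.
move=> S ST.
have [fX dX sX] := log_concave_solid_density uncX lcX.
have [fW dW sW] := log_concave_solid_density uncW lcW.
have [_ mfX fX0 _] := dX; have [_ mfW fW0 _] := dW.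
have mT := measurable_strong_contraction contrT.
have mid : measurable_fun setT (@id (d.-tuple R)) by exact: measurable_id.
(* A solid density is largest at the origin. The maximum with 1 makes [ln M] nonnegative, as the
   splitting of [f ln f] requires. *)
have [M [M1 fWM]] : exists M, 1 <= M /\ forall x, fW x <= M.
  exists (Order.max 1 (fW [tuple 0 | _ < d])).
  split=> [|x]; rewrite le_max ?lexx//; apply/orP; right.
  by rewrite -lee_fin; apply: sW => i; rewrite tnth_mktuple normr0.
have fX1 := integral_density1 dX.
(* The estimates are proved for the convolution densities [f0] and [g0], which are bounded by [M]
   and of which [f0] is solid; arbitrary densities are reduced to them at the end. *)
have [f0 f0E f0M] := bounded_convolution mid mfX fX0 mfW fW0 fX1 fWM.
have [g0 g0E g0M] := bounded_convolution mT mfX fX0 mfW fW0 fX1 fWM.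
have df0 := has_density_convolution mid mfX fX0 mfW fW0 indepXW dX dW f0E.
have dg0 := has_density_convolution mT mfX fX0 mfW fW0 indepXW dX dW g0E.
split; [by exists f0|by exists g0|move=> f g df dg].
have sf0 : solid (EFin \o f0).
  move=> x y xy; rewrite /= !f0E.
  exact: (solid_convolution mfX fX0 mfW fW0 sX sW).
have kf := equidistributed_translate T df0.
have nd := contraction_nondecreasing_comparison indepXW dX dW sW contrT df0 dg0 sf0.
have ni := contraction_nonincreasing_comparison indepXW dX dW sW contrT df0 dg0 sf0.
have [_ mf0 f00 _] := df0; have [_ mg0 g00 _] := dg0.
have [_ mf f_0 _] := df; have [_ mg g_0 _] := dg.
move: kf nd ni; set k := (fun z => f0 _) => kf nd ni.
have mk : measurable_fun setT k.
  by apply: (measurableT_comp mf0); exact: measurable_vsub2.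
have k0 z : 0 <= k z by exact: f00.
have f01 := integral_density1 df0; have g01 := integral_density1 dg0.
split.
  apply: (majorized_of_excess mf f_0 mg g_0).
  - by rewrite (integral_density1 df) ltry.
  - by rewrite (integral_density1 dg) ltry.
  move=> t t0; have mexc : measurable_fun setT (fun y : R => Order.max (y - t) 0).
    by apply: measurable_maxr => //; exact: measurable_funB.
  rewrite (integral_density_comp df df0 mexc) (integral_density_comp dg dg0 mexc).
  exact: (excess_le mf0 mg0 mk f00 g00 f01 kf nd).
move=> al al0; rewrite (renyi_entropy_density al df df0) (renyi_entropy_density al dg dg0).
apply: (le_renyi_entropy al0) => [al1|al1|].
- exact: (integral_powR_ge mf0 mg0 mk f00 g00 k0 f01 kf nd al1 f0M).
- apply: (integral_powR_le mg0 mk f00 g00 k0 kf ni).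
  by rewrite al0 al1.
- exact: (integral_xlnx_le mf0 mg0 mk f00 g00 k0 f01 g01 kf ni M1 f0M g0M).
Qed.
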